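(* Suppose Assumption 2 (stated in the context) is satisfied. Then $$\tilde{Z}_p:=\tilde{T}_{m,p}-2\sqrt{m\log p}\;\to\;0$$ in probability as $n\to\infty$ (so that $p=p_n\to\infty$). Furthermore, $$\lim_{p\to\infty}\mathbb{E}\left[e^{\alpha|\tilde{Z}_p|}\mathbf{1}_{\{|\tilde{Z}_p|\geq\delta\}}\right]=0$$ for all $\alpha>0$ and $\delta>0$.
   Context: Let $p=p_n\to\infty$ as $n\to\infty$, and let $m$ be an integer, $2\le m\le p$, possibly depending on $n$ through $p$. Let $\tilde{W}=(\tilde{w}_{ij})_{1\le i,j\le p}$ be a symmetric random matrix whose entries $\tilde w_{ij}$, $i\le j$, are independent with $\tilde{w}_{ii}\sim N(0,2)$ and $\tilde{w}_{ij}\sim N(0,1)$ for $i<j$. For $S\subset\{1,\dots,p\}$ let $\tilde{W}_S=(\tilde{w}_{ij})_{i,j\in S}$, and let $\lambda_1(A)$ denote the largest eigenvalue of a symmetric matrix $A$. Define $$\tilde{T}_{m,p}=\max_{S\subset\{1,\dots,p\},\,|S|=m}\lambda_1(\tilde{W}_S).$$ Assumption 2: either $m\ge2$ is fixed, or $m\to\infty$ with $m=o\left(\frac{(\log p)^{1/3}}{\log\log p}\right)$. *)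

(* Defs.v *)
From HB Require Import structures.
From mathcomp Require Export all_boot all_order all_algebra.
From mathcomp Require Export all_classical all_reals all_analysis.

Set Implicit Arguments.
Unset Strict Implicit.
Unset Printing Implicit Defensive.

Export numFieldNormedType.Exports.

Import Order.TTheory GRing.Theory Num.Theory.

Local Open Scope classical_set_scope.
Local Open Scope ring_scope.

(* For a symmetric real matrix of positive size the set of eigenvalues is finite
   and nonempty, so that this supremum is a maximum. *)
Definition lambda1 (R : realType) (n : nat) (A : 'M[R]_n) : R :=
  sup [set a : R | eigenvalue A a].

Definition principal_submx (R : realType) (p : nat) (A : 'M[R]_p)
    (S : {set 'I_p}) : 'M[R]_#|S| :=
  \matrix_(i, j) A (enum_val i) (enum_val j).

(* The supremum is over a finite set, nonempty as soon as [m <= p]. *)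
Definition max_lambda1 (R : realType) (m p : nat) (A : 'M[R]_p) : R :=
  sup [set x : R | exists S : {set 'I_p},
         #|S| = m /\ x = lambda1 (principal_submx A S)].

Definition mutually_independent (d : measure_display) (T : measurableType d)
    (R : realType) (P : probability T R) (I : finType) (D : {set I})
    (X : I -> {RV P >-> R}) : Prop :=
  forall (J : {set I}) (B : I -> set R),
    J \subset D -> (forall i, measurable (B i)) ->
    P (\bigcap_(i in [set k | k \in J]) (X i @^-1` B i)) =
    (\prod_(i in J) P (X i @^-1` B i))%E.

(* The second parameter of [normal_prob] is the standard deviation, hence
   [Num.sqrt 2] for the variance 2 of the diagonal entries. *)
Definition gaussian_symmetric (d : measure_display) (T : measurableType d)
    (R : realType) (P : probability T R) (p : nat)
    (W : 'I_p -> 'I_p -> {RV P >-> R}) : Prop :=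
  [/\ forall i j w, W i j w = W j i w,
      mutually_independent [set ij : 'I_p * 'I_p | (ij.1 <= ij.2)%N]%SET
        (fun ij => W ij.1 ij.2),
      forall (i : 'I_p) (B : set R), measurable B ->
        distribution P (W i i) B = normal_prob 0 (Num.sqrt 2) B
    & forall (i j : 'I_p) (B : set R), (i < j)%N -> measurable B ->
        distribution P (W i j) B = normal_prob 0 1 B].

Definition random_mx (d : measure_display) (T : measurableType d)
    (R : realType) (P : probability T R) (p : nat)
    (W : 'I_p -> 'I_p -> {RV P >-> R}) (w : T) : 'M[R]_p :=
  \matrix_(i, j) W i j w.

Definition centered_max (d : measure_display) (T : measurableType d)
    (R : realType) (P : probability T R) (m p : nat)
    (W : 'I_p -> 'I_p -> {RV P >-> R}) (w : T) : R :=
  max_lambda1 m (random_mx W w) - 2 * Num.sqrt (m%:R * ln p%:R).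

(* [p] and [m] are sequences of sizes indexed by the same variable [n]. *)
Definition slow_growth (R : realType) (p m : nat -> nat) : Prop :=
  (exists k : nat, forall n, m n = k) \/
  (m @ \oo --> \oo /\
   (fun n => (m n)%:R : R^o) =o_\oo
   (fun n => ln (p n)%:R `^ 3^-1 / ln (ln (p n)%:R) : R^o)).

Definition cvg_in_probability0 (R : realType) (d : nat -> measure_display)
    (T : forall n, measurableType (d n)) (P : forall n, probability (T n) R)
    (Z : forall n, T n -> R) : Prop :=
  forall eps : R, 0 < eps ->
    P n [set w | eps < `|Z n w|] @[n --> \oo] --> 0%E.

(* Main.v *)
Require Import Defs.
From mathcomp Require Import measurable_realfun ring lra zify.

Import Order.TTheory GRing.Theory Num.Theory.

Local Open Scope classical_set_scope.
Local Open Scope ring_scope.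

(* Write L = 2 sqrt (m ln p). The entries of W_S enter only through events that
   are products over i <= j, so that independence is used for finitely many
   measurable sets at a time and no joint density is needed.

   Upper tail: lambda_1(W_S)^2 is at most the squared Frobenius norm of W_S,
   which is 2 X with X a sum of at most m^2 squares of independent standard
   normal variables; P(X >= y) is at most exp (- y / 2) up to a factor
   (4 (y + 2))^(m^2). With at most p^m = exp (L^2 / 4) choices of S the union
   bound gives P(T >= L + s) <= exp (O(m^2 (s + ln (1 + L))) - s L / 2).

   Lower tail: if all entries of W_S are at least x then lambda_1(W_S) >= m x.
   Take m x = L - s and let S run over the transversals of m blocks of p / m
   indices. Two such events with k common indices share k (k + 1) / 2 entries,
   and the second moment method works because, for 1 <= k <= m,
   k ln p - (k / m)^2 (L - s)^2 / 4 >= min (s L / 4, (ln p) / 2).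

   Assumption 2 gives m^2 ln (1 + L) = o(L), and L = o(ln p) follows. Hence, for all b, c > 0, P(|T - L| >= s) <= exp (- b s) for every
   s >= c as soon as n is large, which gives both claims. *)

Set Implicit Arguments.
Unset Strict Implicit.
Unset Printing Implicit Defensive.

(** * Rayleigh quotients *)

Section Rayleigh.
Variable R : realType.

(** With [A = 1%:M] this is the squared Euclidean norm; the built-in matrix norm is the maximum
    norm. *)
Definition quad n (A : 'M[R]_n) (x : 'rV[R]_n) : R := (x *m A *m x^T) 0 0.

Lemma quadE n (A : 'M[R]_n) x :
  quad A x = \sum_i \sum_j x 0 i * A i j * x 0 j.
Proof.
rewrite /quad mxE exchange_big/=; apply: eq_bigr => j _.
by rewrite !mxE mulr_suml.
Qed.

Lemma quad1E n (x : 'rV[R]_n) : quad 1%:M x = \sum_i x 0 i ^+ 2.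
Proof.
by rewrite /quad mulmx1 mxE; apply: eq_bigr => i _; rewrite mxE expr2.
Qed.

Lemma quad1_ge0 n (x : 'rV[R]_n) : 0 <= quad 1%:M x.
Proof. by rewrite quad1E sumr_ge0// => i _; rewrite sqr_ge0. Qed.

Lemma quad1_eq0 n (x : 'rV[R]_n) : quad 1%:M x = 0 -> x = 0.
Proof.
rewrite quad1E => /eqP; rewrite psumr_eq0 => [/allP x0|i _];
  last exact: sqr_ge0.
apply/rowP => i; rewrite mxE; apply/eqP; rewrite -sqrf_eq0.
exact: (x0 i (mem_index_enum _)).
Qed.

Lemma quad0 n (A : 'M[R]_n) : quad A 0 = 0.
Proof. by rewrite /quad !mul0mx mxE. Qed.

Lemma quadZ n (A : 'M[R]_n) c x : quad A (c *: x) = c ^+ 2 * quad A x.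
Proof.
by rewrite /quad -scalemxAl linearZ/= -scalemxAl -scalemxAr !mxE expr2 mulrA.
Qed.

Lemma quadD n (A : 'M[R]_n) x y : A^T = A ->
  quad A (x + y) = quad A x + 2 * (x *m A *m y^T) 0 0 + quad A y.
Proof.
move=> sA; have E : (x *m A *m y^T) 0 0 = (y *m A *m x^T) 0 0.
  have <- : (x *m A *m y^T)^T = y *m A *m x^T.
    by rewrite !trmx_mul trmxK sA mulmxA.
  by rewrite [RHS]mxE.
rewrite /quad linearD/= !mulmxDl !mulmxDr [in LHS]mxE [in X in X + _]mxE.
rewrite [in X in _ + X]mxE.
rewrite -!/(quad _ _) E; ring.
Qed.

Lemma quad_eigen n (A : 'M[R]_n) a x :
  x *m A = a *: x -> quad A x = a * quad 1%:M x.
Proof. by move=> xA; rewrite /quad xA mulmx1 -scalemxAl mxE. Qed.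

Lemma continuous_sum (T : topologicalType) (I : Type) (r : seq I)
    (f : I -> T -> R) :
  (forall i, continuous (f i)) -> continuous (fun x => \sum_(i <- r) f i x).
Proof.
move=> cf x; elim: r => [|i r IH].
  by under eq_fun do rewrite big_nil; exact: cvg_cst.
rewrite /continuous_at big_cons; under eq_fun do rewrite big_cons.
by apply: (@cvgD _ R^o); [exact: cf|exact: IH].
Qed.

Lemma quad_continuous n (A : 'M[R]_n) : continuous (quad A).
Proof.
have -> : quad A = fun x => \sum_i \sum_j x 0 i * A i j * x 0 j.
  by apply/funext => x; exact: quadE.
apply: continuous_sum => i; apply: continuous_sum => j x.
apply: (@continuousM _ _ (fun x : 'rV[R]_n => x 0 i * A i j)).
  apply: (@continuousM _ _ (fun x : 'rV[R]_n => x 0 i) (fun=> A i j)).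
    exact: coord_continuous.
  exact: cst_continuous.
exact: coord_continuous.
Qed.

(** Along [v + c *: y] with [y = v *m M] the form equals 2 c |y|^2 + c^2 [quad M y], and its linear
    term must vanish for it to stay nonnegative. *)
Lemma psd_quad0 n (M : 'M[R]_n) v : M^T = M ->
  (forall x, 0 <= quad M x) -> quad M v = 0 -> v *m M = 0.
Proof.
move=> sM M0 v0; set y := v *m M; apply: quad1_eq0.
set a := quad _ _; set b := quad M y.
have a0 : 0 <= a by exact: quad1_ge0.
have b0 : 0 <= b by exact: M0.
have key c : 0 <= 2 * c * a + c ^+ 2 * b.
  have := M0 (v + c *: y); rewrite quadD// v0 add0r quadZ -/y.
  by rewrite linearZ/= -scalemxAr mxE /a /quad mulmx1 mulrA.
(* A small negative multiple, where the linear term dominates; [b + 1] avoids a zero denominator. *)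
have := key (- a / (b + 1)).
have -> : 2 * (- a / (b + 1)) * a + (- a / (b + 1)) ^+ 2 * b =
   - (a ^+ 2 * (b + 2) / (b + 1) ^+ 2) by field; apply: lt0r_neq0;
     rewrite ltr_wpDl.
rewrite oppr_ge0 => h; apply/eqP; rewrite -sqrf_eq0; apply/eqP/le_anti.
rewrite sqr_ge0 andbT; move: h.
by rewrite -mulrA pmulr_lle0// divr_gt0//; nra.
Qed.

(** A maximiser [v] of [quad A] on the compact unit sphere makes ([quad A v]) I - A positive
    semidefinite with value 0 at [v], so [v] is an eigenvector by [psd_quad0]. *)
Lemma rayleigh_max n (A : 'M[R]_n.+1) : A^T = A ->
  exists2 a, eigenvalue A a & forall x, quad A x <= a * quad 1%:M x.
Proof.
move=> sA; pose S := [set x : 'rV[R]_n.+1 | quad 1%:M x = 1].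
have S0 : S !=set0.
  exists (delta_mx 0 0); rewrite /S/= quad1E (bigD1 ord0)//= mxE/= expr1n.
  rewrite big1 ?addr0// => i i0.
  by rewrite mxE/= (negbTE i0) expr0n.
have cS : compact S.
  apply: bounded_closed_compact.
    exists 1; split => // M M1 x xS.
    rewrite /= [leLHS]/Num.norm /= mx_normrE; apply/bigmax_leP => /=.
    split; first by apply/ltW/(lt_trans ltr01).
    move=> [i j] _ /=; rewrite (ord1 i); apply: le_trans (ltW M1).
    rewrite -ler_sqr ?nnegrE//= expr1n real_normK ?num_real//.
    rewrite -xS quad1E (bigD1 j)//= lerDl sumr_ge0// => k _; exact: sqr_ge0.
  apply: (@closed_comp _ _ (quad 1%:M) [set 1]); last exact: closed_eq.
  by move=> x _; exact: quad_continuous.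
have cA : {within S, continuous (quad A)}.
  by apply: continuous_subspaceT; exact: quad_continuous.
have [v vS vmax] := EVT_max_rV S0 cS cA.
rewrite inE /S/= in vS.
have max x : quad A x <= quad A v * quad 1%:M x.
  have [x0|x0] := eqVneq (quad 1%:M x) 0.
    by rewrite x0 mulr0 (quad1_eq0 x0) quad0.
  have xp : 0 < quad 1%:M x by rewrite lt_neqAle eq_sym x0 quad1_ge0.
  have /vmax : (Num.sqrt (quad 1%:M x))^-1 *: x \in S.
    by rewrite inE /S/= quadZ exprVn sqr_sqrtr ?quad1_ge0// mulVf.
  by rewrite quadZ exprVn sqr_sqrtr ?quad1_ge0// mulrC ler_pdivrMr.
exists (quad A v) => //.
apply/eigenvalueP; exists v; last first.
  by apply/eqP => v0; move: vS; rewrite v0 quad0; lra.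
have quadB x : quad ((quad A v)%:M - A) x = quad A v * quad 1%:M x - quad A x.
  by rewrite /quad mulmxBr mulmxBl mxE [in X in _ + X]mxE mul_mx_scalar
    -scalemxAl mulmx1 mxE.
have : v *m ((quad A v)%:M - A) = 0.
  apply: psd_quad0 => [|x|].
  - by rewrite linearB/= sA tr_scalar_mx.
  - by rewrite quadB subr_ge0.
  - by rewrite quadB vS mulr1 subrr.
by rewrite mulmxBr mul_mx_scalar => /eqP; rewrite subr_eq0 => /eqP.
Qed.

(** Each eigenvalue is the Rayleigh quotient of its eigenvector, so the maximal quotient, itself an
    eigenvalue, is the supremum. *)
Lemma lambda1P n (A : 'M[R]_n) : (0 < n)%N -> A^T = A ->
  eigenvalue A (lambda1 A) /\ forall x, quad A x <= lambda1 A * quad 1%:M x.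
Proof.
case: n A => // n A _ sA; have [a ea amax] := rayleigh_max sA.
suff -> : lambda1 A = a by [].
have ub : ubound [set a : R | eigenvalue A a] a.
  move=> b /= /eigenvalueP[v vA v0].
  have := amax v; rewrite (quad_eigen vA) ler_pM2r// lt_neqAle quad1_ge0 andbT.
  by rewrite eq_sym; apply: contra v0 => /eqP/quad1_eq0 ->.
apply: le_anti; apply/andP; split.
  by apply: ge_sup => //; exists a.
by apply: ub_le_sup => //; exists a.
Qed.

(** Lagrange's identity: the difference is half a double sum of squares. *)
Lemma sum_sqr_cauchy (I : finType) (a b : I -> R) :
  (\sum_i a i * b i) ^+ 2 <= (\sum_i a i ^+ 2) * (\sum_i b i ^+ 2).
Proof.
rewrite -subr_ge0.
suff -> : (\sum_i a i ^+ 2) * (\sum_i b i ^+ 2) - (\sum_i a i * b i) ^+ 2 =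
    2^-1 * \sum_i \sum_j (a i * b j - a j * b i) ^+ 2.
  rewrite mulr_ge0// sumr_ge0// => i _; rewrite sumr_ge0// => j _.
  exact: sqr_ge0.
rewrite [in RHS](eq_bigr (fun i => \sum_j (a i * b j) ^+ 2 -
    \sum_j (a i * b j * (a j * b i)) *+ 2 + \sum_j (a j * b i) ^+ 2));
      last first.
  move=> i _; rewrite -sumrB -big_split/=; apply: eq_bigr => j _.
  exact: sqrrB.
rewrite big_split/= sumrB.
have e1 : \sum_i \sum_j (a i * b j) ^+ 2 =
    (\sum_i a i ^+ 2) * (\sum_i b i ^+ 2).
  rewrite big_distrl/=; apply: eq_bigr => i _; rewrite big_distrr/=.
  by apply: eq_bigr => j _; rewrite exprMn.
have e2 : \sum_i \sum_j (a j * b i) ^+ 2 =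
    (\sum_i a i ^+ 2) * (\sum_i b i ^+ 2).
  by rewrite exchange_big/= e1.
have e3 : \sum_i \sum_j (a i * b j * (a j * b i)) *+ 2 =
    2 * (\sum_i a i * b i) ^+ 2.
  rewrite expr2 big_distrl/= mulr_sumr; apply: eq_bigr => i _.
  rewrite big_distrr/= mulr_sumr; apply: eq_bigr => j _.
  by rewrite -[in LHS]mulr_natl; ring.
by rewrite e1 e2 e3; field.
Qed.

(** For an eigenvector v of [lambda1 A], the squared norm of v A is [lambda1 A ^+ 2] |v|^2;
    Cauchy-Schwarz bounds it column by column. *)
Lemma lambda1_frobenius n (A : 'M[R]_n) : (0 < n)%N -> A^T = A ->
  lambda1 A ^+ 2 <= \sum_i \sum_j A i j ^+ 2.
Proof.
move=> n0 sA; have [/eigenvalueP[v vA v0] _] := lambda1P n0 sA.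
have vp : 0 < quad 1%:M v.
  rewrite lt_neqAle quad1_ge0 andbT eq_sym.
  by apply: contra v0 => /eqP/quad1_eq0 ->.
rewrite -(ler_pM2r vp) -quadZ -vA quad1E exchange_big/= mulr_suml.
apply: ler_sum => j _; rewrite mxE mulrC quad1E; exact: sum_sqr_cauchy.
Qed.

Lemma lambda1_diag n (A : 'M[R]_n) i : A^T = A -> A i i <= lambda1 A.
Proof.
move=> sA; have n0 : (0 < n)%N by apply: leq_ltn_trans (ltn_ord i).
have [_ /(_ (delta_mx 0 i))] := lambda1P n0 sA.
rewrite quadE quad1E (bigD1 i)//= [X in _ * X](bigD1 i)//= (bigD1 i)//= !mxE/=.
rewrite !eqxx/= mul1r mulr1 !big1 ?addr0 ?expr1n ?mulr1// => j ji.
- by rewrite mxE (negbTE ji) expr0n.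
- by rewrite big1// => k _; rewrite mxE (negbTE ji) !mul0r.
- by rewrite !mxE (negbTE ji) mulr0.
Qed.

(** The test vector is the all-ones vector. *)
Lemma lambda1_mean n (A : 'M[R]_n) : (0 < n)%N -> A^T = A ->
  \sum_i \sum_j A i j <= lambda1 A * n%:R.
Proof.
move=> n0 sA; have [_ /(_ (const_mx 1))] := lambda1P n0 sA.
have -> : quad 1%:M (const_mx 1 : 'rV[R]_n) = n%:R.
  rewrite quad1E (eq_bigr (fun=> 1)) ?sumr_const ?card_ord// => i _.
  by rewrite mxE expr1n.
apply: le_trans; rewrite quadE le_eqVlt; apply/orP; left; apply/eqP.
apply: eq_bigr => i _; apply: eq_bigr => j _.
by rewrite !mxE mulr1 mul1r.
Qed.

End Rayleigh.

(** * The maximum over principal submatrices *)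

Section MaxLambda1.
Variable R : realType.

(** The strict Rayleigh inequality holds at an eigenvector and, by continuity, at rational vectors
    near it. This writes [t < lambda1 A] as a countable union, whence measurability. *)
Lemma lambda1_gt_rat n (A : 'M[R]_n) t : (0 < n)%N -> A^T = A ->
  t < lambda1 A <-> exists x : 'rV[rat]_n,
    t * quad 1%:M (map_mx ratr x) < quad A (map_mx ratr x).
Proof.
move=> n0 sA; have [/eigenvalueP[v vA v0] amax] := lambda1P n0 sA.
split=> [tA|[x tx]]; last first.
  have := lt_le_trans tx (amax _); rewrite -subr_gt0 -mulrBl => h.
  rewrite -subr_gt0; have : 0 <= quad 1%:M (map_mx ratr x : 'rV[R]_n).
    exact: quad1_ge0.
  by move: h; nra.
have vp : 0 < quad 1%:M v.
  rewrite lt_neqAle quad1_ge0 andbT eq_sym.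
  by apply: contra v0 => /eqP/quad1_eq0 ->.
pose G x := quad A x - t * quad 1%:M x.
have cG : continuous G.
  move=> x; apply: (@continuousB R R^o); first exact: quad_continuous.
  by apply: continuousM; [exact: cst_continuous|exact: quad_continuous].
have Gv : 0 < G v by rewrite /G (quad_eigen vA) -mulrBl mulr_gt0// subr_gt0.
have : \forall x \near v, 0 < G x.
  by apply: (@cvgr_gt _ _ _ (nbhs_filter v) _ (G v)) => //; exact: cG.
move=> /nbhs_ballP[e /= e0 ve].
have /choice[q qP] i : exists q : rat, ratr q \in `](v 0 i - e), (v 0 i + e)[.
  by apply: rat_in_itvoo; lra.
exists (\row_i q i); rewrite -subr_gt0; apply: ve; split => // i j.
rewrite (ord1 i) !mxE; have := qP j; rewrite in_itv/= => /andP[? ?].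
by rewrite /ball/= ltr_distlC; apply/andP.
Qed.

(** * Measurability of the largest eigenvalue *)

Section measurable.
Context d (T : measurableType d).

Lemma measurable_quad n (A : T -> 'M[R]_n) x :
  (forall i j, measurable_fun setT (fun w => A w i j)) ->
  measurable_fun setT (fun w => quad (A w) x).
Proof.
move=> mA; under eq_fun do rewrite quadE.
apply: measurable_sum => i; apply: measurable_sum => j.
by apply: measurable_funM => //; apply: measurable_funM.
Qed.

Lemma measurable_lambda1 n (A : T -> 'M[R]_n) : (0 < n)%N ->
  (forall w, (A w)^T = A w) ->
  (forall i j, measurable_fun setT (fun w => A w i j)) ->
  measurable_fun setT (fun w => lambda1 (A w)).
Proof.
move=> n0 sA mA mD; apply: (measurability _ (RGenOInfty.measurableE R)) => //.
move=> _ [_ [t ->] <-]; rewrite setTI.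
have -> : (fun w => lambda1 (A w)) @^-1` `]t, +oo[ = \bigcup_(x : 'rV[rat]_n)
    [set w | t * quad 1%:M (map_mx ratr x) < quad (A w) (map_mx ratr x)].
  apply/seteqP; split => w /=.
    by rewrite in_itv/= andbT => /(lambda1_gt_rat t n0 (sA w))[x ?]; exists x.
  by move=> [x _ /= ?]; rewrite in_itv/= andbT; apply/lambda1_gt_rat => //;
    exists x.
apply: countable_bigcupT_measurable => // x.
rewrite -[X in measurable X]setTI.
have -> : [set: T] `&` [set w | t * quad 1%:M (map_mx ratr x) <
    quad (A w) (map_mx ratr x)] =
  setT `&` (fun w => quad (A w) (map_mx ratr x)) @^-1`
    `]t * quad 1%:M (map_mx ratr x), +oo[.
  by apply/seteqP; split => w /=; rewrite in_itv/= andbT.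
exact: measurable_quad.
Qed.

End measurable.

Section max_lambda1.
Variables (m p : nat).
Implicit Types (A : 'M[R]_p) (S : {set 'I_p}).

Lemma tr_principal_submx A S : A^T = A ->
  (principal_submx A S)^T = principal_submx A S.
Proof. by move=> sA; apply/matrixP => i j; rewrite !mxE -[in LHS]sA mxE. Qed.

Lemma max_lambda1P A : (m <= p)%N -> exists S : {set 'I_p},
  [/\ #|S| = m, max_lambda1 m A = lambda1 (principal_submx A S) &
   forall S' : {set 'I_p}, #|S'| = m ->
     lambda1 (principal_submx A S') <= max_lambda1 m A].
Proof.
move=> mp.
have /card_gt0P[S0] : (0 < #|[set S : {set 'I_p} | #|S| == m]%SET|)%N.
  by rewrite card_draws card_ord bin_gt0.
rewrite inE => S0m; pose F S := lambda1 (principal_submx A S).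
have [S /eqP Sm Smax] := @arg_maxP _ _ _ S0 (fun S => #|S| == m) F S0m.
have ub : ubound [set x : R | exists S : {set 'I_p},
    #|S| = m /\ x = lambda1 (principal_submx A S)] (F S).
  by move=> _ [S' [S'm ->]]; apply: Smax; apply/eqP.
have E : max_lambda1 m A = F S.
  apply: le_anti; apply/andP; split.
    by apply: ge_sup => //; exists (F S), S.
  by apply: ub_le_sup; [exists (F S)|exists S].
by exists S; split => // S' S'm; rewrite E; apply: Smax; apply/eqP.
Qed.

Lemma sum_enum_val2 S (F : 'I_p -> 'I_p -> R) :
  \sum_(i < #|S|) \sum_(j < #|S|) F (enum_val i) (enum_val j) =
  \sum_(i in S) \sum_(j in S) F i j.
Proof.
rewrite [in RHS]big_enum_val; apply: eq_bigr => i _.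
by rewrite [in RHS]big_enum_val.
Qed.

Lemma principal_frobenius A S : (0 < #|S|)%N -> A^T = A ->
  lambda1 (principal_submx A S) ^+ 2 <= \sum_(i in S) \sum_(j in S) A i j ^+ 2.
Proof.
move=> S0 sA; rewrite -(sum_enum_val2 S (fun i j => A i j ^+ 2)).
apply: le_trans (lambda1_frobenius S0 (tr_principal_submx S sA)) _.
rewrite le_eqVlt; apply/orP; left; apply/eqP.
by apply: eq_bigr => i _; apply: eq_bigr => j _; rewrite mxE.
Qed.

Lemma max_lambda1_mean A S : (0 < m <= p)%N -> #|S| = m -> A^T = A ->
  \sum_(i in S) \sum_(j in S) A i j <= max_lambda1 m A * m%:R.
Proof.
move=> /andP[m0 mp] Sm sA; have [_ [_ _ /(_ S Sm) h]] := max_lambda1P A mp.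
apply: le_trans (ler_wpM2r (ler0n _ _) h).
rewrite -sum_enum_val2 -[in X in _ <= _ * X]Sm.
apply: le_trans (lambda1_mean _ (tr_principal_submx S sA)); last by rewrite Sm.
rewrite le_eqVlt; apply/orP; left; apply/eqP.
by apply: eq_bigr => i _; apply: eq_bigr => j _; rewrite mxE.
Qed.

(** Some set of size [m] contains [i]: add [i] to [m.-1] other indices. This controls very negative
    values of the maximum. *)
Lemma max_lambda1_diag A i : (0 < m <= p)%N -> A^T = A ->
  A i i <= max_lambda1 m A.
Proof.
move=> /andP[m0 mp] sA.
have [S Si Sm] : exists2 S : {set 'I_p}, i \in S & #|S| = m.
  have /card_gt0P[S0] :
      (0 < #|[set S : {set 'I_p} | S \subset [set~ i] & #|S| == m.-1]%SET|)%N.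
    by rewrite cards_draws cardsC1 card_ord bin_gt0 -!subn1 leq_sub2r.
  rewrite inE => /andP[/fintype.subsetP S0i /eqP S0m]; exists (i |: S0)%SET.
    by rewrite setU11.
  rewrite cardsU1 S0m; have /negPf -> : i \notin S0.
    by apply/negP => /S0i; rewrite !inE eqxx.
  by rewrite add1n prednK.
have [_ [_ _ /(_ S Sm) ]] := max_lambda1P A mp; apply: le_trans.
have := lambda1_diag (enum_rank_in Si i) (tr_principal_submx S sA).
by rewrite mxE enum_rankK_in.
Qed.

Lemma measurable_max_lambda1 d (T : measurableType d) (A : T -> 'M[R]_p) :
  (0 < m <= p)%N -> (forall w, (A w)^T = A w) ->
  (forall i j, measurable_fun setT (fun w => A w i j)) ->
  measurable_fun setT (fun w => max_lambda1 m (A w)).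
Proof.
move=> /andP[m0 mp] sA mA mD.
apply: (measurability _ (RGenOInfty.measurableE R)) => //.
move=> _ [_ [t ->] <-]; rewrite setTI.
have -> : (fun w => max_lambda1 m (A w)) @^-1` `]t, +oo[ =
   \bigcup_(S in [set S : {set 'I_p} | #|S| = m])
     ((fun w => lambda1 (principal_submx (A w) S)) @^-1` `]t, +oo[).
  apply/seteqP; split => w /=; rewrite in_itv/= andbT.
    have [S [Sm -> _]] := max_lambda1P (A w) mp.
    by move=> tS; exists S => //=; rewrite in_itv/= andbT.
  move=> [S /= Sm]; rewrite in_itv/= andbT => /lt_le_trans; apply.
  by have [_ [_ _ /(_ S Sm)]] := max_lambda1P (A w) mp.
apply: fin_bigcup_measurable; first exact: finite_finset.
move=> S /= Sm; rewrite -[X in measurable X]setTI.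
apply: measurable_lambda1 => //; first by rewrite Sm.
  by move=> w; exact: tr_principal_submx.
by move=> i j; under eq_fun do rewrite mxE; exact: mA.
Qed.

End max_lambda1.
End MaxLambda1.

(** * Gaussian tails and the second moment method *)

Section NormalTail.
Variable R : realType.
Local Notation mu := lebesgue_measure.

(* On [V] the density of N(0, s^2) is at most [exp (- c^2 / (2 s^2))] times the
   density of N(c, s^2). *)
Lemma normal_prob_shift (s c : R) (V : set R) : 0 < s -> measurable V ->
  (forall y, V y -> c ^+ 2 <= c * y) ->
  (normal_prob 0 s V <= (expR (- (c ^+ 2 / (s ^+ 2 *+ 2))))%:E)%E.
Proof.
move=> s0 mV Vc; set e := expR _; have s2 : 0 < s ^+ 2 *+ 2
  by rewrite mulrn_wgt0// exprn_gt0.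
have mpdf (a : R) : measurable_fun V (fun y => (normal_pdf a s y)%:E).
  by apply/measurable_EFinP; apply: measurable_funTS;
    exact: measurable_normal_pdf.
apply: (@le_trans _ _ (\int[mu]_(y in V) (e%:E * (normal_pdf c s y)%:E))%E).
  apply: ge0_le_integral => //.
  - by move=> y _; rewrite lee_fin normal_pdf_ge0.
  - exact: mpdf.
  - by apply: emeasurable_funM; [exact: measurable_cst|exact: mpdf].
  move=> y Vy; rewrite -EFinM lee_fin !normal_pdfE ?gt_eqF// mulrCA.
  rewrite ler_wpM2l ?normal_peak_ge0// /normal_fun -expRD ler_expR.
  rewrite -subr_ge0.
  have -> : - (c ^+ 2 / (s ^+ 2 *+ 2)) + - (y - c) ^+ 2 / (s ^+ 2 *+ 2) -
      - (y - 0) ^+ 2 / (s ^+ 2 *+ 2) =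
      2 * (c * y - c ^+ 2) / (s ^+ 2 *+ 2) by field; rewrite gt_eqF.
  by rewrite divr_ge0 ?mulr_ge0 ?subr_ge0 ?Vc// ltW.
rewrite ge0_integralZl_EFin//; last 3 first.
- by move=> y _; rewrite lee_fin normal_pdf_ge0.
- exact: mpdf.
- exact: expR_ge0.
rewrite -[leRHS]mule1 lee_wpmul2l// ?lee_fin ?expR_ge0//.
rewrite -(integral_normal_pdf c s); apply: ge0_subset_integral => //.
  by apply/measurable_EFinP; exact: measurable_normal_pdf.
by move=> y _; rewrite lee_fin normal_pdf_ge0.
Qed.

(** Integrate only over [s x, s (x + h)] with h = 1 / (1 + x), where the density is smallest at the
    right end. Since h x <= 1 and h <= 1, (x + h)^2 <= x^2 + 3, which costs 3/2 in the exponent; the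
    other 3/2 comes from 1 / sqrt (2 pi) >= exp (- 3/2). *)
Lemma normal_prob_lower (s x : R) : 0 < s -> 0 <= x ->
  ((expR (- (x ^+ 2 / 2) - 3) / (1 + x))%:E <=
    normal_prob 0 s `[(s * x)%R, +oo[%classic)%E.
Proof.
move=> s0 x0; pose h := (1 + x)^-1; have h0 : 0 < h by rewrite invr_gt0; lra.
pose V := `[s * x, s * (x + h)]%classic : set R.
have mV : measurable V by exact: measurable_itv.
pose c := normal_peak s * expR (- ((x + h) ^+ 2 / 2)).
apply: (@le_trans _ _ (\int[mu]_(y in V) (cst c%:E y))%E); last first.
  apply: (@le_trans _ _ (normal_prob 0 s V)).
    apply: ge0_le_integral => //.
    - by move=> y _; rewrite lee_fin mulr_ge0 ?expR_ge0 ?normal_peak_ge0.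
    - by apply/measurable_EFinP; apply: measurable_funTS;
      exact: measurable_normal_pdf.
    move=> y; rewrite /V/= in_itv/= => /andP[y1 y2].
    rewrite lee_fin normal_pdfE ?gt_eqF// ler_wpM2l ?normal_peak_ge0//.
    rewrite ler_expR subr0 mulNr lerN2 ler_pdivrMr ?mulrn_wgt0 ?exprn_gt0//.
    have -> : (x + h) ^+ 2 / 2 * (s ^+ 2 *+ 2) = (s * (x + h)) ^+ 2.
      by rewrite -mulr_natl; field.
    by rewrite ler_pXn2r ?nnegrE//; [apply: le_trans y1; rewrite mulr_ge0//|
      rewrite mulr_ge0//]; lra.
  apply: ge0_subset_integral => //.
    by apply/measurable_EFinP; apply: measurable_funTS;
      exact: measurable_normal_pdf.
    by move=> y _; rewrite lee_fin normal_pdf_ge0.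
  by move=> y; rewrite /V/= !in_itv/= andbT => /andP[].
rewrite integral_cst//= lebesgue_measure_itv/= lte_fin ltr_pM2l// ltrDl h0.
rewrite -EFinB -EFinM lee_fin.
have -> : s * (x + h) - s * x = s * h by ring.
rewrite /c [leRHS](_ : _ = (normal_peak s * s) * expR (- ((x + h) ^+ 2 / 2)) *
  h); last by ring.
rewrite ler_wpM2r ?(ltW h0)//.
have hx : h * x <= 1 by rewrite mulrC ler_pdivrMr; lra.
have h1 : h <= 1 by rewrite invf_le1; lra.
have e32 : normal_peak s * s >= expR (- (3 / 2)).
  rewrite /normal_peak.
  have -> : Num.sqrt (s ^+ 2 * pi *+ 2) = s * Num.sqrt (2 * pi).
    rewrite -mulrnAr -[pi *+ 2]mulr_natl sqrtrM ?sqr_ge0// sqrtr_sqr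
      gtr0_norm//.
  rewrite invfM mulrAC mulVf ?gt_eqF// mul1r expRN lef_pV2 ?posrE ?expR_gt0//;
    last first.
    by rewrite sqrtr_gt0 mulr_gt0// pi_gt0.
  rewrite -ler_sqr ?nnegrE ?expR_ge0// sqr_sqrtr;
    last by rewrite mulr_ge0// pi_ge0.
  have := pihalf_02 R; have := expR_ge1Dx (1 : R);
    rewrite -expRM_natr => e1 /andP[_ p2].
  have -> : 3 / 2 * 2%:R = 1 * 3%:R :> R by field.
  rewrite expRM_natr; apply: (@le_trans _ _ (2 ^+ 3)); first lra.
  by rewrite ler_pXn2r ?nnegrE//; lra.
apply: le_trans (ler_wpM2r (expR_ge0 _) e32); rewrite -expRD ler_expR.
by nra.
Qed.

End NormalTail.

(** * Union bound and second moment inequality *)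

Section Events.
Context d (T : measurableType d) (R : realType) (P : probability T R).

Lemma union_bound (I : finType) (F : {pred I}) (A : I -> set T) (B : set T)
    (b : R) :
  measurable B -> (forall i, measurable (A i)) ->
  (forall w, B w -> exists2 i, i \in F & A i w) ->
  (forall i, i \in F -> (P (A i) <= b%:E)%E) ->
  (P B <= (#|F|%:R * b)%:E)%E.
Proof.
move=> mB mA BA Ab.
have BU : B `<=` \big[setU/set0]_(i <- enum F) A i.
  move=> w /BA[i iF Ai]; rewrite -bigcup_seq; exists i => //=.
  by rewrite mem_enum.
have mU (r : seq I) : measurable (\big[setU/set0]_(i <- r) A i).
  by apply: bigsetU_measurable.
apply: le_trans (le_measure _ _ _ BU) _; rewrite ?inE//.
rewrite cardE; have : all [in F] (enum F) by apply/allP => i; rewrite mem_enum.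
elim: (enum F) => [|i r IH] /=; first by rewrite big_nil measure0 mul0r.
move=> /andP[iF rF]; rewrite big_cons;
  apply: le_trans (measureU2 _ _ _) _ => //.
by rewrite -natr1 mulrDl mul1r addrC EFinD leeD ?Ab ?IH.
Qed.

(** Both sides of the inequality integrated in the second moment argument are encoded as lists of
    coefficients and events. *)
Lemma integral_indic_sum (r : seq (R * set T)) :
  (forall a, a \in r -> 0 <= a.1) -> (forall a, a \in r -> measurable a.2) ->
  (\int[P]_w (\sum_(a <- r) a.1 * \1_(a.2) w)%:E =
   (\sum_(a <- r) a.1 * fine (P a.2))%:E)%E.
Proof.
elim: r => [|a r IH] r0 mr.
  by rewrite big_nil; under eq_integral do rewrite big_nil; rewrite integral0.
have mi (b : R * set T) : b \in a :: r -> measurable_fun setT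
  (fun w => (b.1 * \1_(b.2) w)%:E).
  move=> br; apply/measurable_EFinP; apply: measurable_funM => //.
  by apply: measurable_indic; exact: mr.
under eq_integral do rewrite big_cons EFinD.
rewrite big_cons EFinD -IH; last 2 first.
- by move=> b br; apply: r0; rewrite inE br orbT.
- by move=> b br; apply: mr; rewrite inE br orbT.
have a0 : 0 <= a.1 by apply: r0; rewrite mem_head.
rewrite ge0_integralD//; last 4 first.
- by move=> w _; rewrite lee_fin mulr_ge0// indicE ler0n.
- by apply: mi; rewrite mem_head.
- move=> w _; rewrite lee_fin big_seq sumr_ge0// => b br.
  by rewrite mulr_ge0 ?indicE ?ler0n//; apply: r0; rewrite inE br orbT.
- apply/measurable_EFinP; rewrite [X in measurable_fun _ X](_ : _ = fun w =>
     \sum_(b <- r) (if b \in r then b.1 * \1_(b.2) w else 0)); last first.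
    by apply/funext => w; rewrite big_seq [RHS]big_seq; apply: eq_bigr => b ->.
  apply: measurable_sum => b; have [br|//] := boolP (b \in r).
  by apply/measurable_EFinP; apply: mi; rewrite inE br orbT.
congr (_ + _)%E; under eq_integral do rewrite EFinM.
rewrite ge0_integralZl_EFin//; last first.
  apply/measurable_EFinP; apply: measurable_indic; apply: mr; exact: mem_head.
rewrite integral_indic//; last by apply: mr; exact: mem_head.
by rewrite setIT EFinM fineK// fin_num_measure//; apply: mr; exact: mem_head.
Qed.

(* Integrate [M^2 1_B + 2 M N <= N^2 + M^2], where [N] counts the events that
   occur, [B] is the event [N = 0] and [M = E N]. *)
Lemma second_moment (I : finType) (A : I -> set T) (M : R) :
  (forall i, measurable (A i)) -> 0 < M -> M = \sum_i fine (P (A i)) ->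
  fine (P (\bigcap_i ~` A i)) <=
  (\sum_i \sum_j fine (P (A i `&` A j))) / M ^+ 2 - 1.
Proof.
move=> mA M0 EM; set B := \bigcap_i _; set S := \sum_i _.
have mB : measurable B.
  by apply: fin_bigcap_measurable => // i _; exact: measurableC.
(* [r1] encodes M^2 1_B + 2 M N, and [r2] encodes M^2 + N^2 with N^2 expanded into indicators of
   pairwise intersections. *)
pose r1 := (M ^+ 2, B) :: [seq (2 * M, A i) | i <- index_enum I].
pose r2 := (M ^+ 2, setT) ::
  [seq (1, A ij.1 `&` A ij.2) | ij <- index_enum (I * I)%type].
have : (\int[P]_w (\sum_(a <- r1) a.1 * \1_(a.2) w)%:E <=
        \int[P]_w (\sum_(a <- r2) a.1 * \1_(a.2) w)%:E)%E.
  apply: ge0_le_integral => //.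
  - move=> w _; rewrite lee_fin big_cons big_map addr_ge0//=.
      by rewrite mulr_ge0 ?sqr_ge0 ?indicE ?ler0n.
    by rewrite sumr_ge0// => i _; rewrite !mulr_ge0 ?indicE ?ler0n// ltW.
  - apply/measurable_EFinP; under eq_fun do rewrite big_cons big_map/=.
    apply: measurable_funD.
      by apply: measurable_funM => //; exact: measurable_indic.
    apply: measurable_sum => i.
    by apply: measurable_funM => //; exact: measurable_indic.
  - apply/measurable_EFinP; under eq_fun do rewrite big_cons big_map/=.
    apply: measurable_funD.
      by apply: measurable_funM => //; exact: measurable_indic.
    apply: measurable_sum => i; apply: measurable_funM => //.
    by apply: measurable_indic; exact: measurableI.
  move=> w _; rewrite lee_fin !big_cons !big_map/= -mulr_sumr indicT mulr1.
  pose N : R := \sum_i \1_(A i) w; rewrite -/N.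
  have -> : \sum_(ij : I * I) 1 * \1_(A ij.1 `&` A ij.2) w = N ^+ 2.
    rewrite expr2 /N big_distrl/=; under [in RHS]eq_bigr
      do rewrite big_distrr/=.
    rewrite [in RHS]pair_bigA/=; apply: eq_bigr => ij _.
    by rewrite mul1r indicI.
  have [wB|wB] := pselect (B w).
    have -> : N = 0.
      rewrite /N big1// => i _; rewrite indicE memNset//; exact: wB.
    by rewrite indicE mem_set//= expr0n !(mulr0, addr0, mulr1).
  rewrite indicE memNset//= mulr0 add0r -subr_ge0.
  have -> : M ^+ 2 + N ^+ 2 - 2 * M * N = (M - N) ^+ 2 by ring.
  exact: sqr_ge0.
rewrite !integral_indic_sum; last 4 first.
- move=> a; rewrite inE => /orP[/eqP ->|/mapP[i _ ->]] //=; exact: sqr_ge0.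
- move=> a; rewrite inE => /orP[/eqP ->|/mapP[i _ ->]] //=; exact: measurableI.
- move=> a; rewrite inE => /orP[/eqP ->|/mapP[i _ ->]] /=; first exact: sqr_ge0.
  by rewrite mulr_ge0// ltW.
- by move=> a; rewrite inE => /orP[/eqP ->|/mapP[i _ ->]] //=.
rewrite lee_fin !big_cons !big_map/= -mulr_sumr -EM probability_setT/= mulr1.
have -> : \sum_(ij : I * I) 1 * fine (P (A ij.1 `&` A ij.2)) = S.
  by rewrite /S pair_bigA/=; apply: eq_bigr => ij _; rewrite mul1r.
move=> h; rewrite lerBrDr ler_pdivlMr ?exprn_gt0//; nra.
Qed.

End Events.

(** * The upper tail *)

(** The positions of the independent entries of the principal submatrix on [S]. *)
Definition upairs p (S : {set 'I_p}) : {set 'I_p * 'I_p} :=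
  [set e | [&& e.1 \in S, e.2 \in S & (e.1 <= e.2)%N]]%SET.

Lemma sum_upairs (V : nmodType) p (S : {set 'I_p}) (f : 'I_p -> 'I_p -> V) :
  (forall i j, f i j = f j i) ->
  \sum_(i in S) \sum_(j in S) f i j =
  \sum_(e in upairs S) f e.1 e.2 *+ (if e.1 == e.2 then 1 else 2).
Proof.
move=> fC; rewrite pair_big/= (bigID (fun e : 'I_p * 'I_p => e.1 <= e.2)%N)/=.
have -> : \sum_(i | (i.1 \in S) && (i.2 \in S) && ~~ (i.1 <= i.2)%N) f i.1 i.2 =
   \sum_(i | (i.1 \in S) && (i.2 \in S) && (i.1 < i.2)%N) f i.1 i.2.
  rewrite (reindex_inj (can_inj (@swap_pairK _ _)))/=.
  apply: eq_big => [[i j]|[i j] _]/=; last exact: fC.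
  by rewrite -ltnNge [(j \in S) && _]andbC.
rewrite [in RHS](eq_bigr (fun e => f e.1 e.2 +
  (if e.1 == e.2 then 0 else f e.1 e.2))); last first.
  by move=> e _; case: ifP => _; rewrite ?mulr1n ?addr0// mulr2n.
rewrite big_split/=; congr (_ + _); first by apply: eq_bigl => e;
  rewrite inE andbA.
rewrite big_mkcond [in RHS]big_mkcond; apply: eq_bigr => -[i j] _/=;
  rewrite inE/= andbA.
rewrite ltn_neqAle; have [->|ij] := eqVneq i j;
  first by rewrite eqxx andbF if_same.
by rewrite -val_eqE/= in ij; rewrite ij.
Qed.

Section Upper.
Context d (T : measurableType d) (R : realType) (P : probability T R).

Lemma measurable_RV (X : {RV P >-> R}) (B : set R) :
  measurable B -> measurable (X @^-1` B).
Proof. by move=> mB; rewrite -[X in measurable X]setTI;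
  exact: measurable_funP. Qed.

Lemma measurable_ge (f : T -> R) t : measurable_fun setT f ->
  measurable [set w | t <= f w].
Proof.
move=> mf; rewrite -[X in measurable X]setTI.
rewrite (_ : _ `&` _ = setT `&` f @^-1` `[t, +oo[); first by apply: mf.
by apply/seteqP; split => w /=; rewrite in_itv/= andbT.
Qed.

Lemma measurable_lt (f : T -> R) t : measurable_fun setT f ->
  measurable [set w | f w < t].
Proof.
move=> mf; rewrite (_ : [set w | _] = ~` [set w | t <= f w]).
  by apply: measurableC; exact: measurable_ge.
by apply/seteqP; split => w /=; rewrite leNgt;
  [move=> ->|move/negP; rewrite negbK].
Qed.

Lemma measurable_sumsq (I : finType) (J : {pred I}) (X : I -> {RV P >-> R}) c :
  measurable_fun setT (fun w => \sum_(i in J) c i * X i w ^+ 2).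
Proof.
under eq_fun do rewrite big_mkcond.
apply: measurable_sum => i; have [_|//] := boolP (i \in J).
by apply: measurable_funM => //; apply: measurable_funX.
Qed.

Lemma indep_prod (I : finType) (D J : {set I}) (X : I -> {RV P >-> R})
    (B : I -> set R) :
  mutually_independent D X -> J \subset D -> (forall i, measurable (B i)) ->
  P (\bigcap_(i in [set k | k \in J]) (X i @^-1` B i)) =
  (\prod_(i in J) fine (P (X i @^-1` B i)))%:E.
Proof.
move=> indX JD mB; rewrite indX//.
rewrite (eq_bigr (fun i => (fine (P (X i @^-1` B i)))%:E)) => [|i _];
  last first.
  by rewrite fineK// fin_num_measure//; exact: measurable_RV.
by apply/esym; apply: (big_morph EFin).
Qed.

(** The event is the union of the two half-lines beyond [s * Num.sqrt k] in absolute value; the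
    shift bound gives exp (- k / 2) for each. *)
Lemma normal_sq_tail (X : {RV P >-> R}) (s k : R) : 0 < s -> 0 <= k ->
  (forall B, measurable B -> distribution P X B = normal_prob 0 s B) ->
  (P (X @^-1` [set x | (k <= s ^- 2 * x ^+ 2)%R]) <=
    (2 * expR (- (k / 2)))%:E)%E.
Proof.
move=> s0 k0 dX; pose c := s * Num.sqrt k.
have c0 : 0 <= c by rewrite mulr_ge0 ?sqrtr_ge0// ltW.
have c2 : c ^+ 2 = s ^+ 2 * k by rewrite exprMn sqr_sqrtr.
have -> : X @^-1` [set x | k <= s ^- 2 * x ^+ 2] =
    X @^-1` `]-oo, - c] `|` X @^-1` `[c, +oo[.
  apply/seteqP; split => w /=; rewrite !in_itv/= andbT mulrC ler_pdivlMr
    ?exprn_gt0//.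
    rewrite mulrC -c2 -(ger0_norm (sqr_ge0 (X w))) normrX ler_pXn2r ?nnegrE//.
    by rewrite ler_normr => /orP[?|?]; [right|left; rewrite lerNr].
  rewrite mulrC -c2 -(ger0_norm (sqr_ge0 (X w))) normrX ler_pXn2r ?nnegrE//.
  by rewrite ler_normr => -[?|->//]; apply/orP; right; rewrite lerNr.
have e2 : c ^+ 2 / (s ^+ 2 *+ 2) = k / 2.
  by rewrite c2 -mulr_natl; field; rewrite gt_eqF.
apply: le_trans (measureU2 _ _ _) _; [exact: measurable_RV..|].
rewrite mulr2n mulrDl mul1r EFinD -e2; apply: leeD.
  rewrite -[leLHS]/(distribution P X _) dX// -sqrrN;
    apply: normal_prob_shift => //.
  move=> y /=; rewrite in_itv/= => yc; rewrite mulNr sqrrN expr2 lerNr -mulrN.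
  by rewrite ler_wpM2l// lerNr; lra.
rewrite -[leLHS]/(distribution P X _) dX//; apply: normal_prob_shift => //.
by move=> y /=; rewrite in_itv/= andbT => yc; rewrite expr2 ler_wpM2l.
Qed.

(* The squares are rounded down to integers capped at [K]; every rounded
   configuration has probability at most [(2 exp (1/2))^#|J| exp (- y / 2)]. *)
Lemma sumsq_tail (I : finType) (D J : {set I}) (X : I -> {RV P >-> R})
    (c : I -> R) (y : R) :
  mutually_independent D X -> J \subset D -> (forall i, 0 <= c i) -> 0 <= y ->
  (forall i (k : nat), i \in J ->
    (P (X i @^-1` [set x | (k%:R <= c i * x ^+ 2)%R]) <=
      (2 * expR (- (k%:R / 2)))%:E)%E) ->
  (P [set w | (y <= \sum_(i in J) c i * X i w ^+ 2)%R] <=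
    ((4 * (y + 2)) ^+ #|J| * expR (- (y / 2)))%:E)%E.
Proof.
(* Since [K] exceeds [y], one coordinate that reaches the cap already accounts for the whole level
   [y]. *)
move=> indX JD c0 y0 tX; pose K := (Num.truncn y).+1.
have yK : y <= K%:R by apply/ltW; exact: truncnS_gt.
have Ky : K%:R <= y + 1 by rewrite -natr1 lerD2r truncn_le.
(* Rounding down loses at most 1 per coordinate, hence the [+ 1]. Fixing the value 0 off [J] keeps
   the count at [K.+1 ^ #|J|]. *)
pose F := [set f : {ffun I -> 'I_K.+1} | (f \in pffun_on ord0 (mem J) predT)
   && (y <= \sum_(i in J) ((f i)%:R + 1))]%SET.
pose B (f : {ffun I -> 'I_K.+1}) i := [set x : R | (f i)%:R <= c i * x ^+ 2].
pose A f := \bigcap_(i in [set k | k \in J]) (X i @^-1` B f i).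
have mB f i : measurable (B f i).
  rewrite -[X in measurable X]setTI.
  rewrite (_ : _ `&` _ = setT `&` (fun x => c i * x ^+ 2) @^-1`
    `[(f i)%:R, +oo[).
    have : measurable_fun setT (fun x : R => c i * x ^+ 2).
      by apply: measurable_funM => //; exact: exprn_measurable.
    by apply.
  by apply/seteqP; split => x /=; rewrite in_itv/= andbT.
have mA f : measurable (A f).
  apply: fin_bigcap_measurable; first exact: finite_finset.
  by move=> i _; exact: measurable_RV.
have FJ : (#|F|%:R <= (y + 2) ^+ #|J| :> R).
  apply: (@le_trans _ _ ((K.+1)%:R ^+ #|J|)).
    rewrite -natrX ler_nat; apply: (leq_trans
      (n := #|pffun_on (ord0 : 'I_K.+1) (mem J) predT|)).
      by apply: subset_leq_card; apply/fintype.subsetP => f;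
        rewrite inE => /andP[].
    by rewrite card_pffun_on card_ord.
  rewrite lerXn2r// ?nnegrE ?ler0n//; first lra.
  by rewrite -natr1; lra.
have e12 : expR (2^-1 : R) <= 2.
  have := expR_ge1Dx (- 2^-1 : R); rewrite expRN => h.
  rewrite -[leRHS]invrK -[leLHS]invrK lef_pV2 ?posrE ?invr_gt0 ?expR_gt0//; lra.
have bA f : f \in F -> (P (A f) <= (4 ^+ #|J| * expR (- (y / 2)))%:E)%E.
  rewrite inE => /andP[_ fy]; rewrite /A (indep_prod indX JD)// lee_fin.
  apply: (@le_trans _ _ (\prod_(i in J) (2 * expR (- ((f i)%:R / 2))))).
    apply: ler_prod => i iJ; rewrite fine_ge0//= -lee_fin fineK
      ?fin_num_measure//.
      exact: tX.
    exact: measurable_RV.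
  rewrite (_ : 4 = 2 * 2 :> R); last by rewrite -natrM.
  rewrite big_split/= prodr_const exprMn -mulrA ler_wpM2l ?exprn_ge0//
    -expR_sum.
  apply: le_trans (ler_wpM2r (expR_ge0 _) (lerXn2r #|J| _ _ e12));
    rewrite ?nnegrE ?expR_ge0//.
  rewrite -expRM_natr -expRD ler_expR sumrN lerNl opprD opprK -mulr_suml.
  rewrite big_split/= sumr_const in fy.
  by lra.
apply: le_trans (union_bound (F := mem F) (A := A) _ mA _ bA) _.
- by apply: measurable_ge; exact: measurable_sumsq.
- move=> w /= yw.
  pose f := [ffun i => if i \in J then
    inord (minn K (Num.truncn (c i * X i w ^+ 2))) else ord0 : 'I_K.+1].
  have cX i : 0 <= c i * X i w ^+ 2 by rewrite mulr_ge0// sqr_ge0.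
  have fJ i : i \in J -> f i = minn K (Num.truncn (c i * X i w ^+ 2)) :> nat.
    by move=> iJ; rewrite ffunE iJ inordK// ltnS geq_minl.
  exists f; last first.
    move=> i /= iJ; rewrite /B/= fJ//;
      apply: le_trans (_ : (Num.truncn (c i * X i w ^+ 2))%:R <= _).
      by rewrite ler_nat geq_minr.
    by rewrite truncn_le.
  change (f \in F); rewrite inE; apply/andP; split.
    apply/pffun_onP; split => //; apply/supportP => i.
    by rewrite ffunE => /negPf ->.
  (* Either some coordinate is capped and suffices alone, or no cap is active and every summand is
     within 1 of its rounding. *)
  have [i /andP[iJ Ki]|fK] := pickP
    (fun i => (i \in J) && (K <= Num.truncn (c i * X i w ^+ 2))%N).
    rewrite (bigD1 i)//= fJ// (minn_idPl Ki); apply: le_trans yK _.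
    by rewrite -addrA lerDl addr_ge0// sumr_ge0// => j _; rewrite addr_ge0.
  apply: le_trans yw _; apply: ler_sum => i iJ; rewrite fJ//.
  have := fK i; rewrite iJ/= => /negbT; rewrite -ltnNge => /ltnW/minn_idPr ->.
  by rewrite natr1; apply/ltW/truncnS_gt.
by rewrite lee_fin mulrA ler_wpM2r ?expR_ge0// exprMn mulrC ler_wpM2l
  ?exprn_ge0.
Qed.

(** The weight 1/2 normalises the variance 2 on the diagonal, so all positions share one tail. *)
Lemma normal_pair_tail p (W : 'I_p -> 'I_p -> {RV P >-> R}) (e : 'I_p * 'I_p)
  (k : nat) :
  gaussian_symmetric W -> (e.1 <= e.2)%N ->
  (P (W e.1 e.2 @^-1` [set x | (k%:R <= (if e.1 == e.2 then 2^-1 else 1) *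
    x ^+ 2)%R]) <=
      (2 * expR (- (k%:R / 2)))%:E)%E.
Proof.
move=> [sW iW dW oW]; rewrite leq_eqVlt val_eqE; case: eqP => [<- _|_ /= lt].
  have := normal_sq_tail (s := Num.sqrt 2) (X := W e.1 e.1) (k := k%:R).
  by rewrite sqr_sqrtr// sqrtr_gt0; apply => //; exact: dW.
have := normal_sq_tail (s := 1) (X := W e.1 e.2) (k := k%:R).
by rewrite expr1n invr1; apply => // B; exact: oW.
Qed.

Lemma measurable_max_random_mx m p (W : 'I_p -> 'I_p -> {RV P >-> R}) :
  gaussian_symmetric W -> (0 < m <= p)%N ->
  measurable_fun setT (fun w => max_lambda1 m (random_mx W w)).
Proof.
move=> [sW _ _ _] mp; apply: measurable_max_lambda1 => //.
  by move=> w; apply/matrixP => i j; rewrite !mxE sW.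
by move=> i j; under eq_fun do rewrite mxE; exact: measurable_funP.
Qed.

Lemma max_lambda1_upper m p (W : 'I_p -> 'I_p -> {RV P >-> R}) t :
  gaussian_symmetric W -> (0 < m <= p)%N -> 0 <= t ->
  (P [set w | (t <= max_lambda1 m (random_mx W w))%R] <=
   ('C(p, m)%:R * ((4 * (t ^+ 2 / 2 + 2)) ^+ (m ^ 2) *
     expR (- (t ^+ 2 / 4))))%:E)%E.
Proof.
move=> gW mp t0; have [sW iW dW oW] := gW; have /andP[m0 mlp] := mp.
have sM w : (random_mx W w)^T = random_mx W w.
  by apply/matrixP => i j; rewrite !mxE sW.
(* The squared Frobenius norm is twice this weighted sum: off-diagonal squares occur twice, diagonal
   ones once. *)
pose c (e : 'I_p * 'I_p) : R := if e.1 == e.2 then 2^-1 else 1.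
pose A S := [set w | t ^+ 2 / 2 <= \sum_(e in upairs S) c e * W e.1 e.2 w ^+ 2].
rewrite -[p in 'C(p, m)]card_ord -card_draws.
apply: (union_bound (A := A)).
- by apply: measurable_ge; exact: measurable_max_random_mx.
- move=> S; apply: measurable_ge.
  exact: (measurable_sumsq _ (fun e : 'I_p * 'I_p => W e.1 e.2)).
- move=> w /=; have [S [Sm -> _]] := max_lambda1P (random_mx W w) mlp.
  move=> tS; exists S; first by rewrite inE Sm.
  rewrite /A/= ler_pdivrMr//; apply: (@le_trans _ _
    (lambda1 (principal_submx (random_mx W w) S) ^+ 2)).
    by rewrite lerXn2r ?nnegrE// (le_trans t0).
  apply: le_trans (principal_frobenius _ (sM w)) _; first by rewrite Sm.
  have sym i j : random_mx W w i j ^+ 2 = random_mx W w j i ^+ 2.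
    by rewrite !mxE sW.
  rewrite (sum_upairs S sym).
  rewrite mulr_suml le_eqVlt; apply/orP; left; apply/eqP.
  by apply: eq_bigr => e _; rewrite /c mxE -mulr_natr; case: ifP => _; field.
move=> S; rewrite inE => /eqP Sm.
have JD : upairs S \subset [set ij : 'I_p * 'I_p | (ij.1 <= ij.2)%N]%SET.
  by apply/fintype.subsetP => e; rewrite !inE => /and3P[].
(* The crude count m^2 is enough, as the base of the power is at least 1. *)
have Jm : (#|upairs S| <= m ^ 2)%N.
  rewrite -Sm expnS expn1 -cardsX; apply: subset_leq_card.
  by apply/fintype.subsetP => e; rewrite !inE => /and3P[-> ->].
have t2 : 0 <= t ^+ 2 by exact: sqr_ge0.
apply: le_trans (sumsq_tail iW JD _ _ _) _.
- by move=> e; rewrite /c; case: ifP.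
- lra.
- by move=> e k; rewrite inE => /and3P[_ _ e12]; exact: normal_pair_tail.
rewrite lee_fin; have -> : t ^+ 2 / 2 / 2 = t ^+ 2 / 4 by field.
by rewrite ler_wpM2r ?expR_ge0// ler_weXn2l//; lra.
Qed.

End Upper.

(** * The lower tail *)

Section Pairs.
Variable p : nat.
Implicit Type S : {set 'I_p}.

Lemma upairsI S S' : upairs (S :&: S') = upairs S :&: upairs S'.
Proof.
apply/setP => e; rewrite !inE.
by do !case: (_ \in _); rewrite /= ?andbF// andbb.
Qed.

Lemma prod_upairs (R : comPzSemiRingType) S (a b : R) :
  \prod_(e in upairs S) (if e.1 == e.2 then a else b) =
  a ^+ #|S| * b ^+ (#|S| ^ 2 - #|S|)./2.
Proof.
have Ed : #|[set e in upairs S | e.1 == e.2]%SET| = #|S|.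
  rewrite -(card_imset _ (f := fun i : 'I_p => (i, i))); last by move=> i j [].
  apply: eq_card => -[i j]; rewrite !inE/=; apply/idP/imsetP => /=.
    by move=> /andP[/and3P[iS _ _] /eqP <-]; exists i.
  by move=> [k kS [-> ->]]; rewrite kS leqnn eqxx.
(* Counting ordered pairs through [sum_upairs] gives the number of off-diagonal positions. *)
have : (\sum_(i in S) \sum_(j in S) 1 =
    \sum_(e in upairs S) (if e.1 == e.2 then 1 else 2))%N.
  apply: etrans (@sum_upairs nat p S (fun _ _ => 1%N) (fun _ _ => erefl)) _.
  by apply: eq_bigr => e _; case: ifP.
rewrite sum_nat_const sum1_card mulnn (bigID (fun e => e.1 == e.2))/=.
set n1 := (X in _ = (X + _)%N); set n2 := (X in _ = (_ + X)%N).
have -> : n1 = #|S|.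
  rewrite -Ed -sum1_card; apply: eq_big => e; first by rewrite !inE.
  by move=> /andP[_ ->].
have En2 : n2 = (#|[set e in upairs S | e.1 != e.2]%SET|.*2)%N.
  rewrite -muln2 -sum_nat_const; apply: eq_big => e; first by rewrite !inE.
  by move=> /andP[_ /negPf ->].
move=> ->; rewrite addnC addnK En2 doubleK.
rewrite (bigID (fun e => e.1 == e.2))/=; congr (_ * _).
  rewrite -Ed -prodr_const; apply: eq_big => e; first by rewrite !inE.
  by move=> /andP[_ ->].
rewrite -prodr_const; apply: eq_big => e; first by rewrite !inE.
by move=> /andP[_ /negPf ->].
Qed.

End Pairs.

(** A multiplicative inclusion-exclusion, which relates the joint probability of two events to their
    shared entries without division. *)
Lemma prod_setUI (R : comPzSemiRingType) (I : finType) (A B : {set I})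
  (F : I -> R) :
  (\prod_(i in A :|: B) F i) * (\prod_(i in A :&: B) F i) =
  (\prod_(i in A) F i) * (\prod_(i in B) F i).
Proof.
rewrite (big_setID A)/= finset.setUK finset.setDUl finset.setDv finset.set0U
  [in RHS](big_setID (A := B) A)/=.
by rewrite -mulrA [in RHS]finset.setIC [X in _ * X]mulrC.
Qed.

(** * Transversals of disjoint blocks and their overlaps *)

Section Blocks.
Variables m q p : nat.
Hypothesis mqp : (m * q <= p)%N.

Lemma block_subproof (i : 'I_m) (a : 'I_q) : (i * q + a < p)%N.
Proof.
apply: leq_trans mqp; apply: (@leq_trans (i.+1 * q)).
  by rewrite mulSn addnC ltn_add2r.
by rewrite leq_mul2r ltn_ord orbT.
Qed.

Definition block i a : 'I_p := Ordinal (block_subproof i a).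

Lemma block_inj i j a b : block i a = block j b -> i = j /\ a = b.
Proof.
move=> /(congr1 val)/= E; have q0 : (0 < q)%N by apply: leq_ltn_trans
  (ltn_ord a).
have Ei : i = j.
  apply: val_inj => /=; have := congr1 (divn^~ q) E.
  by rewrite !divnMDl// !divn_small// !addn0.
by split => //; apply: val_inj; move: E; rewrite Ei => /addnI.
Qed.

Definition transv (s : {ffun 'I_m -> 'I_q}) : {set 'I_p} :=
  [set block i (s i) | i : 'I_m]%SET.

Lemma card_transv s : #|transv s| = m.
Proof. by rewrite card_imset ?card_ord// => i j /block_inj[]. Qed.

(** The blocks are disjoint, so a common index forces the same block and the same choice in it. *)
Lemma card_transvI s t : #|transv s :&: transv t| = #|[pred i | s i == t i]|.
Proof.
rewrite -(card_imset _ (f := fun i => block i (s i)));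
  last by move=> i j /block_inj[].
apply: eq_card => k; rewrite inE; apply/andP/imsetP.
  move=> [/imsetP[i _ ->] /imsetP[j _ /block_inj[<- E]]].
  by exists i => //; rewrite inE E.
move=> [i]; rewrite inE => /eqP E ->; split; apply/imsetP; exists i => //.
by rewrite E.
Qed.

(* Summing over [t] coordinate by coordinate, each coordinate contributes
   [q + (q - 1)]. *)
Lemma sum_agree (R : realType) (s : {ffun 'I_m -> 'I_q}) : (0 < q)%N ->
  \sum_(t : {ffun 'I_m -> 'I_q}) q%:R ^+ #|[pred i | s i == t i]|
    <= (2 * q%:R) ^+ m :> R.
Proof.
move=> q0.
have -> : \sum_(t : {ffun 'I_m -> 'I_q}) q%:R ^+ #|[pred i | s i == t i]| =
    \sum_(t : {ffun 'I_m -> 'I_q}) \prod_i (if s i == t i then q%:R else 1) :>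
      R.
  apply: eq_bigr => t _; rewrite -big_mkcond/= prodr_const; congr (_ ^+ _).
rewrite -(bigA_distr_bigA (fun i a => if s i == a then q%:R else 1 : R)).
have -> : (2 * q%:R) ^+ m = \prod_(i < m) (2 * q%:R) :> R.
  by rewrite prodr_const card_ord.
apply: ler_prod => i _; rewrite sumr_ge0/=; last by move=> a _; case: ifP.
rewrite (bigD1 (s i))//= eqxx mulr2n mulrDl mul1r lerD2l.
apply: (@le_trans _ _ (\sum_(a < q) 1)); last by rewrite sumr_const card_ord.
rewrite [leLHS]big_mkcond/=; apply: ler_sum => a _.
by case: eqVneq => //= sa; rewrite eq_sym (negPf sa).
Qed.

End Blocks.

Section Lower.
Context d (T : measurableType d) (R : realType) (P : probability T R).
Variables (p : nat) (W : 'I_p -> 'I_p -> {RV P >-> R}).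
Hypothesis gW : gaussian_symmetric W.
Variable x : R.
Hypothesis x0 : 0 <= x.

Let x1 : 0 < 1 + x. Proof. exact: ltr_wpDr. Qed.

Definition high (S : {set 'I_p}) : set T :=
  \bigcap_(e in [set e | e \in upairs S]) (W e.1 e.2 @^-1` `[x, +oo[).

Lemma measurable_high S : measurable (high S).
Proof.
apply: fin_bigcap_measurable; first exact: finite_finset.
by move=> e _; exact: measurable_RV.
Qed.

Definition hit (e : 'I_p * 'I_p) : R :=
  if e.1 == e.2 then fine (normal_prob 0 (Num.sqrt 2)
    (`[x, +oo[%classic : set R))
  else fine (normal_prob 0 1 (`[x, +oo[%classic : set R)).

Lemma prob_prod (J : {set 'I_p * 'I_p}) :
  J \subset [set ij : 'I_p * 'I_p | (ij.1 <= ij.2)%N]%SET ->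
  P (\bigcap_(e in [set e | e \in J]) (W e.1 e.2 @^-1` `[x, +oo[)) =
  (\prod_(e in J) hit e)%:E.
Proof.
move=> JD; have [_ iW dW oW] := gW; rewrite (indep_prod iW JD)//.
congr (_%:E); apply: eq_bigr => e /(fintype.subsetP JD); rewrite inE.
rewrite leq_eqVlt val_eqE /hit; case: eqP => [<- _|_ /= lt].
  by rewrite -[P _]/(distribution P (W e.1 e.1) _) dW.
by rewrite -[P _]/(distribution P (W e.1 e.2) _) oW.
Qed.

Lemma upairs_sub (S : {set 'I_p}) :
  upairs S \subset [set ij : 'I_p * 'I_p | (ij.1 <= ij.2)%N]%SET.
Proof. by apply/fintype.subsetP => e; rewrite !inE => /and3P[]. Qed.

(** The probability of [high S] for a set [S] of size [k]: [k] diagonal and k (k - 1) / 2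
    off-diagonal factors. *)
Definition phigh (k : nat) : R :=
  fine (normal_prob 0 (Num.sqrt 2) (`[x, +oo[%classic : set R)) ^+ k *
  fine (normal_prob 0 1 (`[x, +oo[%classic : set R)) ^+ (k ^ 2 - k)./2.

Lemma prod_hit S : \prod_(e in upairs S) hit e = phigh #|S|.
Proof. exact: prod_upairs. Qed.

Lemma prob_high S : P (high S) = (phigh #|S|)%:E.
Proof. by rewrite prob_prod ?upairs_sub// prod_hit. Qed.

Lemma prob_highI S S' :
  fine (P (high S `&` high S')) * phigh #|S :&: S'| = phigh #|S| * phigh #|S'|.
Proof.
have -> : high S `&` high S' =
    \bigcap_(e in [set e | e \in upairs S :|: upairs S'])
      (W e.1 e.2 @^-1` `[x, +oo[).
  apply/seteqP; split => [w [wS wS'] e /=|w wSS].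
    by rewrite inE => /orP[/wS|/wS'].
  by split => e /= eS; apply: wSS => /=; rewrite inE eS ?orbT.
rewrite prob_prod; last by rewrite finset.subUset !upairs_sub.
by rewrite -!prod_hit upairsI prod_setUI.
Qed.

(** The Gaussian bound at [x / s]; as [s] is at least 1, enlarging the denominator to [1 + x] gives
    both standard deviations the same prefactor. *)
Lemma fine_normal_lower s : 1 <= s ->
  expR (- (x ^+ 2 / s ^+ 2 / 2) - 3) / (1 + x) <=
  fine (normal_prob 0 s (`[x, +oo[%classic : set R)).
Proof.
move=> s1; have s0 : 0 < s by lra.
have xs : 0 <= x / s by rewrite divr_ge0// ltW.
rewrite -lee_fin fineK; last by apply: fin_num_measure; exact: measurable_itv.
apply: le_trans (le_trans _ (normal_prob_lower s0 xs)) _; last first.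
  by rewrite mulrC divfK ?gt_eqF.
rewrite lee_fin expr_div_n ler_wpM2l ?expR_ge0// lef_pV2 ?posrE//;
  last exact: ltr_wpDr.
by rewrite lerD2l ler_pdivrMr// ler_peMr.
Qed.

(** With N off-diagonal pairs, k^2 = k + 2 N. Diagonal factors contribute x^2 / 4 to the exponent
    and off-diagonal ones x^2 / 2, hence x^2 k^2 / 4 in total. The prefactor is at most 1 and occurs
    k + N <= k^2 times. *)
Lemma phigh_lower k :
  (expR (- 3) / (1 + x)) ^+ (k ^ 2) * expR (- (x ^+ 2 * k%:R ^+ 2 / 4)) <=
    phigh k.
Proof.
set c := expR (- 3) / (1 + x).
have c0 : 0 < c by rewrite divr_gt0 ?expR_gt0.
have c1 : c <= 1.
  rewrite ler_pdivrMr// mul1r; apply: (@le_trans _ _ 1); last by rewrite lerDl.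
  by rewrite expR_le1; lra.
have E s : expR (- (x ^+ 2 / s ^+ 2 / 2) - 3) / (1 + x) = c *
  expR (- (x ^+ 2 / s ^+ 2 / 2)).
  by rewrite expRD /c; ring.
have h1 := fine_normal_lower (lexx 1).
have h2 : 1 <= Num.sqrt 2 :> R.
  by rewrite -[leLHS]sqrtr1 ler_sqrt//; lra.
move/fine_normal_lower : h2 => h2.
rewrite E expr1n divr1 in h1; rewrite E sqr_sqrtr// in h2.
clearbody c; rewrite /phigh; set N := (_)./2.
have EN : (k ^ 2 = k + N.*2)%N.
  rewrite /N halfK; have : ~~ odd (k ^ 2 - k).
    by rewrite oddB ?leq_pexp2l//; [rewrite oddX/= addbb|case: (k) => // k';
      rewrite -{1}[k'.+1]expn1 leq_pexp2l].
  move=> /negPf ->; rewrite subn0 subnKC//.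
  by case: (k) => // k'; rewrite -{1}[k'.+1]expn1 leq_pexp2l.
apply: le_trans (ler_pM _ _ (lerXn2r k _ _ h2) (lerXn2r N _ _ h1));
  rewrite ?nnegrE ?exprn_ge0 ?mulr_ge0 ?expR_ge0 ?(ltW c0)// ?fine_ge0//.
rewrite [leRHS](_ : _ = c ^+ (k + N) * (expR (- (x ^+ 2 / 2 / 2)) ^+ k *
    expR (- (x ^+ 2 / 2)) ^+ N)); last by rewrite !exprMn exprD mulrACA.
rewrite -!expRM_natr -expRD.
apply: ler_pM; rewrite ?exprn_ge0 ?expR_ge0 ?(ltW c0)//.
  by apply: ler_wiXn2l => //; [exact: ltW|rewrite EN -addnn leq_add2l leq_addr].
rewrite ler_expR.
have -> : k%:R ^+ 2 = k%:R + N%:R * 2 :> R.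
  by rewrite -natrX EN natrD -muln2 natrM.
by lra.
Qed.

Lemma phigh_gt0 k : 0 < phigh k.
Proof.
apply: lt_le_trans (phigh_lower k).
by rewrite mulr_gt0 ?expR_gt0// exprn_gt0// divr_gt0 ?expR_gt0.
Qed.

Lemma high_max (m : nat) (S : {set 'I_p}) w : (0 < m <= p)%N -> #|S| = m ->
  high S w ->
  m%:R * x <= max_lambda1 m (random_mx W w).
Proof.
move=> mp Sm Sw; have [sW _ _ _] := gW; have m0 : 0 < m%:R :> R.
  by case/andP: mp; rewrite ltr0n.
rewrite -(ler_pM2r m0).
have sM : (random_mx W w)^T = random_mx W w.
  by apply/matrixP => i j; rewrite !mxE sW.
apply: le_trans (max_lambda1_mean mp Sm sM).
apply: (@le_trans _ _ (\sum_(i in S) \sum_(j in S) x)).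
  have -> : \sum_(i in S) \sum_(j in S) x = m%:R * x * m%:R => //.
  by rewrite !sumr_const Sm -[LHS]mulr_natr -[x *+ m]mulr_natl.
apply: ler_sum => i iS; apply: ler_sum => j jS; rewrite mxE.
have h a b : a \in S -> b \in S -> (a <= b)%N -> x <= W a b w.
  move=> aS bS ab; have := Sw (a, b); rewrite /= in_itv/= andbT; apply.
  by rewrite inE/= aS bS ab.
by case: (leqP i j) => [|/ltnW] ij; [exact: h|rewrite sW; exact: h].
Qed.

(** Two transversals agreeing in k > 0 blocks have joint probability [phigh m ^+ 2 / phigh k], at
    most [phigh m ^+ 2 * (1 + b * q%:R ^+ k)]. Summing with [sum_agree] makes the second moment at
    most M^2 (1 + 2^m b). *)
Lemma max_lambda1_lower (m q : nat) (b : R) :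
  (0 < m)%N -> (0 < q)%N -> (m * q <= p)%N -> 0 <= b ->
  (forall k, (0 < k <= m)%N -> 1 <= b * (q%:R ^+ k *
     ((expR (- 3) / (1 + x)) ^+ (k ^ 2) *
       expR (- (x ^+ 2 * k%:R ^+ 2 / 4))))) ->
  (P [set w | (max_lambda1 m (random_mx W w) < m%:R * x)%R] <=
    (2 ^+ m * b)%:E)%E.
Proof.
move=> m0 q0 mqp b0 hb.
have mp : (0 < m <= p)%N.
  by rewrite m0/=; apply: leq_trans mqp; rewrite leq_pmulr.
pose A (s : {ffun 'I_m -> 'I_q}) := high (transv mqp s).
have mA s : measurable (A s) by exact: measurable_high.
have mB : measurable (\bigcap_s ~` A s).
  by apply: fin_bigcap_measurable => // s _; exact: measurableC.
have mT : measurable [set w | max_lambda1 m (random_mx W w) < m%:R * x].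
  by apply: measurable_lt; exact: measurable_max_random_mx.
apply: (@le_trans _ _ (P (\bigcap_s ~` A s))).
  apply: le_measure; rewrite ?inE// => w /= wT s _ ws.
  by have := high_max mp (card_transv mqp s) ws; rewrite leNgt wT.
have Q0 : 0 < q%:R :> R by rewrite ltr0n.
pose M : R := \sum_s fine (P (A s)).
have EM : M = (q%:R ^+ m) * phigh m.
  rewrite /M (eq_bigr (fun=> phigh m)) => [|s _]; last first.
    by rewrite /A prob_high card_transv.
  by rewrite sumr_const card_ffun !card_ord -[LHS]mulr_natl natrX.
have M0 : 0 < M by rewrite EM mulr_gt0 ?exprn_gt0 ?phigh_gt0.
rewrite -[P _]fineK ?fin_num_measure// lee_fin.
apply: le_trans (second_moment mA M0 erefl) _.
rewrite lerBlDr ler_pdivrMr ?exprn_gt0//.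
have inner s : \sum_t fine (P (A s `&` A t)) <=
    phigh m ^+ 2 * (q%:R ^+ m + b * (2 * q%:R) ^+ m).
  have -> : q%:R ^+ m = \sum_(t : {ffun 'I_m -> 'I_q}) 1 :> R.
    by rewrite sumr_const card_ffun !card_ord natrX.
  apply: (@le_trans _ _ (phigh m ^+ 2 * (\sum_(t : {ffun 'I_m -> 'I_q})
     (1 + b * q%:R ^+ #|[pred i | s i == t i]|)))); last first.
    rewrite ler_wpM2l ?sqr_ge0// big_split/= lerD2l -mulr_sumr ler_wpM2l//.
    exact: sum_agree.
  rewrite mulr_sumr; apply: ler_sum => t _.
  have := prob_highI (transv mqp s) (transv mqp t).
  rewrite !card_transv card_transvI -expr2 => <-; set k := #|_|.
  rewrite -mulrA ler_peMr ?fine_ge0//.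
  (* Disjoint transversals give independent events, as [phigh 0] is 1. *)
  have [->|k0] := posnP k.
    by rewrite /phigh (_ : (0 ^ 2 - 0)./2 = 0%N)// !expr0 mulr1 !mul1r mulr1
      lerDl.
  have km : (k <= m)%N by rewrite -[m in (_ <= m)%N]card_ord; exact: max_card.
  have := hb k; rewrite k0 km => /(_ isT) /le_trans; apply.
  rewrite mulrDr mulr1 mulrA; apply: (@le_trans _ _ (b * q%:R ^+ k * phigh k)).
    by rewrite ler_wpM2l ?mulr_ge0 ?exprn_ge0 ?ler0n// phigh_lower.
  by rewrite [leLHS]mulrC -[leLHS]add0r -mulrA lerD2r ltW// phigh_gt0.
apply: (@le_trans _ _ (\sum_(s : {ffun 'I_m -> 'I_q})
  phigh m ^+ 2 * (q%:R ^+ m + b * (2 * q%:R) ^+ m))).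
  by apply: ler_sum => s _; exact: inner.
rewrite sumr_const card_ffun !card_ord -[leLHS]mulr_natl natrX EM.
move: (phigh m) => g; rewrite !exprMn.
by rewrite le_eqVlt; apply/orP; left; apply/eqP; ring.
Qed.

End Lower.

(** * Tail bounds around the centering *)

Lemma bin_le_expn n k : ('C(n, k) <= n ^ k)%N.
Proof.
apply: (@leq_trans (n ^_ k)); first by rewrite -bin_ffact leq_pmulr// fact_gt0.
elim: k => [|k IH]; first by rewrite ffactn0.
by rewrite ffactnSr expnSr leq_mul// leq_subr.
Qed.

Lemma two_le_expR1 (R : realType) : (2 : R) <= expR 1.
Proof. by have := expR_ge1Dx (1 : R); lra. Qed.

Definition scale (R : realType) (m p : nat) : R :=
  2 * Num.sqrt (m%:R * ln p%:R).

Section Tails.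
Context d (T : measurableType d) (R : realType) (P : probability T R).
Variables (m p : nat) (W : 'I_p -> 'I_p -> {RV P >-> R}).
Hypothesis gW : gaussian_symmetric W.
Hypothesis mp : (2 <= m <= p)%N.

Local Notation l := (ln (p%:R : R)).
Local Notation L := (scale R m p).
Local Notation Z := (centered_max m W).
(* The cost, on the exponential scale, of the union over the entries of one
   principal submatrix. *)
Local Notation a := (m%:R ^+ 2 * (1 + ln (1 + L))).

Lemma scaleP : [/\ (2 : R) <= m%:R, 0 <= l, 0 <= L,
  L ^+ 2 = 4 * m%:R * l & 0 <= ln (1 + L)].
Proof.
have /andP[m2 mlp] := mp; have l0 : 0 <= l.
  by rewrite ln_ge0// ler1n (leq_trans _ mlp)// ltnW.
have L0 : 0 <= L by rewrite mulr_ge0// sqrtr_ge0.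
split => //; first by rewrite ler_nat.
  by rewrite exprMn sqr_sqrtr ?mulr_ge0//; ring.
by rewrite ln_ge0// lerDl.
Qed.

Let p2 : (2 <= p)%N. Proof. by case/andP: mp; exact: leq_trans. Qed.
Let m0p : (0 < m <= p)%N. Proof. by case/andP: mp => /ltnW -> ->. Qed.
Let p0 : 0 < p%:R :> R. Proof. by rewrite ltr0n ltnW. Qed.

Lemma measurable_centered_max : measurable_fun setT Z.
Proof.
by apply: measurable_funB => //; exact: measurable_max_random_mx.
Qed.

Lemma measurable_centered_lt t : measurable [set w | Z w < t].
Proof. by apply: measurable_lt; exact: measurable_centered_max. Qed.

Lemma upper_tail s : 0 <= s ->
  (P [set w | (s <= Z w)%R] <=
   (expR (3 * a + 2 * s * m%:R ^+ 2 - s * L / 2))%:E)%E.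
Proof.
have [m2 l0 L0 L2 lnL0] := scaleP.
move=> s0; have t0 : 0 <= L + s by rewrite addr_ge0.
have -> : [set w | s <= Z w] = [set w | L + s <= max_lambda1 m (random_mx W w)].
  by apply/seteqP; split => w /=; rewrite /centered_max lerBrDr addrC.
apply: le_trans (max_lambda1_upper gW m0p t0) _; rewrite lee_fin.
(* This is p^m, because L^2 / 4 = m ln p. *)
have hC : 'C(p, m)%:R <= expR (L ^+ 2 / 4).
  have -> : L ^+ 2 / 4 = l * m%:R by rewrite L2; field.
  by rewrite expRM_natr lnK ?posrE// -natrX ler_nat bin_le_expn.
have h3 : (8 : R) <= expR 3.
  have -> : (3 : R) = 1 * 3%:R by rewrite mul1r.
  rewrite expRM_natr; apply: (@le_trans _ _ (2 ^+ 3)); first by lra.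
  by rewrite lerXn2r ?nnegrE ?expR_ge0 ?two_le_expR1.
(* Uses 1 + L + s <= (1 + L) exp s and 8 <= exp 3; the third logarithm is slack that gives the form
   3 (1 + ln (1 + L)). *)
have h4 : 4 * ((L + s) ^+ 2 / 2 + 2) <= expR (3 * (1 + ln (1 + L)) + 2 * s).
  apply: (@le_trans _ _ (8 * ((1 + L) * expR s) ^+ 2)).
    apply: (@le_trans _ _ (8 * (1 + (L + s)) ^+ 2)); first by nra.
    rewrite ler_wpM2l// lerXn2r ?nnegrE ?mulr_ge0 ?expR_ge0 ?addr_ge0//.
    apply: (@le_trans _ _ ((1 + L) * (1 + s))); first by nra.
    by rewrite ler_wpM2l ?addr_ge0// expR_ge1Dx.
  have -> : 3 * (1 + ln (1 + L)) + 2 * s =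
    3 + (ln (1 + L) + s) * 2%:R + ln (1 + L) by ring.
  rewrite (expRD (3 + _)) (expRD 3) expRM_natr (expRD (ln _)) lnK ?posrE
    ?ltr_wpDr//.
  rewrite -[leLHS]mulr1; apply: ler_pM => //; last by rewrite lerDl.
    by rewrite mulr_ge0// sqr_ge0.
  by rewrite ler_wpM2r ?sqr_ge0.
apply: (@le_trans _ _ (expR (L ^+ 2 / 4) *
  (expR (3 * (1 + ln (1 + L)) + 2 * s) ^+ (m ^ 2)
    * expR (- ((L + s) ^+ 2 / 4))))).
  apply: ler_pM => //; first by rewrite mulr_ge0 ?expR_ge0// exprn_ge0//; nra.
  rewrite ler_wpM2r ?expR_ge0// lerXn2r ?nnegrE ?expR_ge0//; nra.
rewrite -expRM_natr -!expRD ler_expR natrX.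
move: (ln _) => y; nra.
Qed.

(** On this event the maximum itself is below [- u], hence so is a fixed diagonal entry, which has
    law N(0, 2). *)
Lemma far_lower_tail u : 0 <= u ->
  (P [set w | (Z w < - (L + u))%R] <= (expR (- (u ^+ 2 / 4)))%:E)%E.
Proof.
move=> u0; have [sW _ dW _] := gW; have [m2 l0 L0 L2 lnL0] := scaleP.
have i : 'I_p by exact: (Ordinal (ltnW p2)).
have sM w : (random_mx W w)^T = random_mx W w.
  by apply/matrixP => j k; rewrite !mxE sW.
have mV : measurable (`]-oo, - u]%classic : set R) by exact: measurable_itv.
apply: (@le_trans _ _ (P (W i i @^-1` `]-oo, - u]))).
  apply: le_measure; rewrite ?inE//;
    [exact: measurable_centered_lt|exact: measurable_RV|].
  move=> w /=; rewrite in_itv/= /centered_max -/(scale R m p) => h.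
  have := max_lambda1_diag i m0p (sM w); rewrite mxE; lra.
rewrite -[leLHS]/(distribution P (W i i) _) dW//.
have -> : u ^+ 2 / 4 = (- u) ^+ 2 / (Num.sqrt 2 ^+ 2 *+ 2) :> R.
  by rewrite sqrrN sqr_sqrtr// -mulr_natr; congr (_ / _); ring.
apply: normal_prob_shift => //.
by move=> y /=; rewrite in_itv/= => yu; nra.
Qed.

Lemma lower_tail s : 0 <= s <= L ->
  (P [set w | (Z w < - s)%R] <=
   (expR (6 * a) * (expR (- (s * L / 4)) + expR (- (l / 2))))%:E)%E.
Proof.
have [m2 l0 L0 L2 lnL0] := scaleP.
move=> /andP[s0 sL]; pose q := (p %/ m)%N.
have m0 : (0 < m)%N by case/andP: m0p.
have mR : 0 < m%:R :> R by rewrite ltr0n.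
have q0 : (0 < q)%N by rewrite divn_gt0//; case/andP: mp.
have mqp : (m * q <= p)%N by rewrite mulnC; exact: leq_trunc_div.
pose x := (L - s) / m%:R; have x0 : 0 <= x by rewrite divr_ge0 ?subr_ge0// ltW.
have xL : x <= L by rewrite ler_pdivrMr//; nra.
have -> : [set w | Z w < - s] =
    [set w | max_lambda1 m (random_mx W w) < m%:R * x].
  have -> : m%:R * x = L - s by rewrite mulrC divfK// gt_eqF.
  by apply/seteqP; split => w /=; rewrite /centered_max -/(scale R m p); lra.
(* The exponent collects 2 m^2, lost by replacing [q ^ k] with p^k, and m^2 (3 + ln (1 + L)), lost
   in the Gaussian prefactors. The two summands serve the cases k = m and k < m. *)
pose b := expR (m%:R ^+ 2 * (5 + ln (1 + L))) *
  (expR (- (s * L / 4)) + expR (- (l / 2))).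
have b0 : 0 <= b by rewrite mulr_ge0 ?addr_ge0 ?expR_ge0.
apply: le_trans (max_lambda1_lower gW x0 m0 q0 mqp b0 _) _; last first.
  rewrite lee_fin /b mulrA ler_wpM2r ?addr_ge0 ?expR_ge0//.
  apply: (@le_trans _ _ (expR (1 * m%:R) *
    expR (m%:R ^+ 2 * (5 + ln (1 + L))))).
    rewrite ler_wpM2r ?expR_ge0// expRM_natr lerXn2r ?nnegrE ?expR_ge0//.
    exact: two_le_expR1.
  rewrite -expRD ler_expR; move: lnL0; move: (ln _) => y y0; nra.
move=> k /andP[k0 km].
have kR : 1 <= k%:R :> R by rewrite ler1n.
have kmR : k%:R <= m%:R :> R by rewrite ler_nat.
have hq : expR (k%:R * l - 2 * m%:R ^+ 2) <= q%:R ^+ k.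
  (* Rounding in [p %/ m] costs at most a factor 2, since [q] is positive. *)
  have qp : p%:R <= q%:R * (2 * m%:R) :> R.
    rewrite -!natrM ler_nat; have := divn_eq p m; have := ltn_pmod p m0.
    by rewrite -/q; nia.
  apply: (@le_trans _ _ (expR ((l - 2 * m%:R) * k%:R))).
    by rewrite ler_expR; nra.
  rewrite expRM_natr lerXn2r ?nnegrE ?expR_ge0//.
  rewrite expRD lnK ?posrE// expRN ler_pdivrMr ?expR_gt0//.
  apply: le_trans qp _; rewrite ler_wpM2l//.
  by have := expR_ge1Dx (2 * m%:R : R); lra.
have hk : expR (- (m%:R ^+ 2 * (3 + ln (1 + L)))) <= (expR (- 3) / (1 + x)) ^+
  (k ^ 2).
  have c0 : 0 < 1 + x by rewrite ltr_wpDr.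
  apply: (@le_trans _ _ (expR ((- (3 + ln (1 + L))) * (k ^ 2)%:R))).
    rewrite ler_expR natrX mulNr lerN2 mulrC ler_wpM2r ?addr_ge0//.
    by rewrite lerXn2r ?nnegrE.
  rewrite expRM_natr lerXn2r ?nnegrE ?expR_ge0 ?mulr_ge0 ?expR_ge0 ?invr_ge0
    ?(ltW c0)//.
  rewrite opprD expRD ler_wpM2l ?expR_ge0// expRN lnK ?posrE ?ltr_wpDr//.
  by rewrite lef_pV2 ?posrE ?ltr_wpDr// lerD2l.
pose r := k%:R / m%:R : R.
have Er : k%:R = r * m%:R by rewrite divfK// gt_eqF.
have hx : x ^+ 2 * k%:R ^+ 2 / 4 <= (m%:R * l - s * L / 4) * r ^+ 2.
  have -> : x ^+ 2 * k%:R ^+ 2 / 4 = (L - s) ^+ 2 / 4 * r ^+ 2.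
    by rewrite /x /r; field; rewrite gt_eqF.
  (* As s <= L, (L - s)^2 <= L^2 - s L, and L^2 / 4 = m l. *)
  rewrite ler_wpM2r ?sqr_ge0//; move: L2; move: s0 sL; move: (L) => t; nra.
(* For k = m the ratio [r] is 1 and s L / 4 remains. For k < m the main term is l k (m - k) / m, and
   k (m - k) >= m - 1 >= m / 2. *)
have key : s * L / 4 <= k%:R * l - (m%:R * l - s * L / 4) * r ^+ 2 \/
    l / 2 <= k%:R * l - (m%:R * l - s * L / 4) * r ^+ 2.
  move: km; rewrite leq_eqVlt => /orP[/eqP E|km].
    left; have -> : r = 1 by rewrite /r E divff// gt_eqF.
    by rewrite E; lra.
  right; have km1 : k%:R + 1 <= m%:R :> R by rewrite natr1 ler_nat.
  have rm : r * m%:R * (1 - r) >= 2^-1.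
    have -> : r * m%:R * (1 - r) = k%:R * (m%:R - k%:R) / m%:R.
      by rewrite /r; field; rewrite gt_eqF.
    by rewrite ler_pdivlMr//; nra.
  have sL0 : 0 <= s * L by rewrite mulr_ge0.
  rewrite Er; have : 0 <= (s * L / 4) * r ^+ 2 by rewrite mulr_ge0 ?sqr_ge0//
    divr_ge0.
  by move: rm l0; nra.
set X := x ^+ 2 * _ / 4 in hx *.
apply: (@le_trans _ _ (b * (expR (k%:R * l - 2 * m%:R ^+ 2) *
   (expR (- (m%:R ^+ 2 * (3 + ln (1 + L)))) * expR (- X))))); last first.
  rewrite ler_wpM2l//; apply: ler_pM => //; rewrite ?mulr_ge0 ?expR_ge0//.
  by rewrite ler_wpM2r ?expR_ge0.
set e1 := s * L / 4 in b b0 hx key *; set e2 := l / 2 in b b0 key *.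
have bge : expR (m%:R ^+ 2 * (5 + ln (1 + L)) - e1) <= b /\
    expR (m%:R ^+ 2 * (5 + ln (1 + L)) - e2) <= b.
  by rewrite !expRD /b; split; rewrite ler_wpM2l ?expR_ge0// ?lerDl ?lerDr
    expR_ge0.
rewrite -!expRD; case: key bge => key [bge1 bge2].
  apply: le_trans (ler_wpM2r (expR_ge0 _) bge1).
  by rewrite -expRD -[leLHS]expR0 ler_expR; move: (ln (1 + L)) => y; lra.
apply: le_trans (ler_wpM2r (expR_ge0 _) bge2).
by rewrite -expRD -[leLHS]expR0 ler_expR; move: (ln (1 + L)) => y; lra.
Qed.

End Tails.

(** * Asymptotics *)

Section Small.
Context d (T : measurableType d) (R : realType) (P : probability T R).
Variables (m p : nat) (W : 'I_p -> 'I_p -> {RV P >-> R}).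
Hypothesis gW : gaussian_symmetric W.
Hypothesis mp : (2 <= m <= p)%N.

Local Notation l := (ln (p%:R : R)).
Local Notation L := (scale R m p).
Local Notation Z := (centered_max m W).
Local Notation a := (m%:R ^+ 2 * (1 + ln (1 + L))).

(** The cost is at least m^2 >= 4. Squaring m^2 <= e L gives m^4 <= 4 e^2 m l, so m^3 <= 4 e^2 l;
    then L^2 = 4 m l <= m^3 l <= (2 e l)^2. *)
Lemma scale_small e : 0 < e -> a <= e * L ->
  [/\ m%:R ^+ 2 <= e * L, 4 <= e * L, 0 < L & L <= 2 * e * l].
Proof.
move=> e0 ae; have [m2 l0 L0 L2 lnL0] := scaleP R mp.
have m2e : m%:R ^+ 2 <= e * L.
  by apply: le_trans ae; rewrite ler_peMr ?sqr_ge0// lerDl.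
have e4 : 4 <= e * L by nra.
have Lp : 0 < L by nra.
split => //; rewrite -(@ler_pXn2r _ 2) ?nnegrE ?mulr_ge0 ?(ltW e0)//.
have : m%:R * m%:R ^+ 3 <= m%:R * (4 * e ^+ 2 * l).
  have -> : m%:R * (4 * e ^+ 2 * l) = (e * L) ^+ 2 by rewrite exprMn L2; ring.
  rewrite -exprS (_ : 4 = 2 * 2)%N// exprM ler_pXn2r ?nnegrE ?sqr_ge0//.
  by rewrite mulr_ge0// ltW.
rewrite ler_pM2l; last lra.
move=> h; rewrite L2.
apply: (@le_trans _ _ (m%:R ^+ 3 * l)).
  by rewrite ler_wpM2r// exprS; nra.
have -> : (2 * e * l) ^+ 2 = 4 * e ^+ 2 * l * l by ring.
by rewrite ler_wpM2r.
Qed.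

(** Of the gain s L / 2, one eighth of s L pays for 2 s m^2, another for 3 a, and the remaining
    quarter exceeds b s because L >= 4 b. *)
Lemma upper_tail_exp e b c s : 0 < e -> a <= e * L -> 0 < b -> 0 < c ->
  96 * e <= c -> e * (16 * (b + 1)) <= 1 -> c <= s ->
  (P [set w | (s <= Z w)%R] <= (expR (- (b * s)))%:E)%E.
Proof.
move=> e0 ae b0 c0 ec eb cs; have [m2e e4 Lp _] := scale_small e0 ae.
apply: le_trans (upper_tail gW mp _) _; first by lra.
rewrite lee_fin ler_expR.
have L4 : 4 * b <= L.
  rewrite -(ler_pM2l e0); apply: le_trans e4; nra.
have h1 : 2 * s * m%:R ^+ 2 <= s * L / 8.
  have : 2 * s * m%:R ^+ 2 <= 2 * s * (e * L) by rewrite ler_wpM2l//; lra.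
  have : e * (s * L) <= 16^-1 * (s * L) by rewrite ler_wpM2r ?mulr_ge0//; nra.
  by lra.
have h2 : 3 * a <= s * L / 8.
  have : 24 * e * L <= s * L by rewrite ler_wpM2r//; lra.
  by lra.
have : s * (4 * b) <= s * L by rewrite ler_wpM2l//; lra.
by lra.
Qed.

(** Both exponents are brought below - b s - 1, the spare 1 absorbing the factor 2. The second uses
    s <= L <= 2 e l. *)
Lemma lower_tail_exp_mid e b c s : 0 < e -> a <= e * L -> 0 < b -> 0 < c ->
  96 * e <= c -> e * (8 * (b + 1)) <= 1 -> c <= s <= L ->
  (P [set w | (Z w < - s)%R] <= (expR (- (b * s)))%:E)%E.
Proof.
move=> e0 ae b0 c0 ec eb /andP[cs sL]; have [m2e e4 Lp Ll] := scale_small e0 ae.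
apply: le_trans (lower_tail gW mp _) _; first by rewrite sL andbT; lra.
rewrite lee_fin.
have L8 : 32 * (b + 1) <= L.
  rewrite -(ler_pM2l e0); apply: le_trans e4; nra.
have h1 : 6 * a - s * L / 4 <= - (b * s) - 1.
  have t1 : 96 * e * L <= s * L by rewrite ler_wpM2r//; lra.
  have t2 : s * (8 * b) <= s * L by rewrite ler_wpM2l//; lra.
  by lra.
have h2 : 6 * a - l / 2 <= - (b * s) - 1.
  have t1 : b * s <= b * L by rewrite ler_wpM2l// ltW.
  have t2 : 6 * e * L <= 1 * L by rewrite ler_wpM2r//; nra.
  have t3 : (b + 2) * L <= l / 2.
    apply: (@le_trans _ _ ((b + 2) * (2 * e * l))).
      by rewrite ler_wpM2l//; lra.
    have l0 : 0 <= l by have [] := scaleP R mp.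
    have -> : (b + 2) * (2 * e * l) = (4 * e * (b + 2)) * (l / 2) by field.
    by rewrite ler_piMl//; nra.
  by lra.
rewrite mulrDr -!expRD; apply: (@le_trans _ _ (2 * expR (- (b * s) - 1))).
  have e1 := h1; have e2 := h2; rewrite -ler_expR in e1;
    rewrite -ler_expR in e2.
  by move: e1 e2; lra.
rewrite expRD mulrCA ler_piMr ?expR_ge0// (expRN 1) ler_pdivrMr ?expR_gt0//
  mul1r.
exact: two_le_expR1.
Qed.

(** Three ranges: up to L the second moment bound; up to 2 L monotonicity and the bound at L with
    rate 2 b; beyond 2 L a single diagonal entry, whose quadratic exponent wins. *)
Lemma lower_tail_exp e b c s : 0 < e -> a <= e * L -> 0 < b -> 0 < c ->
  96 * e <= c -> e * (16 * (b + 1)) <= 1 -> e * c <= 1 -> c <= s ->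
  (P [set w | (Z w < - s)%R] <= (expR (- (b * s)))%:E)%E.
Proof.
move=> e0 ae b0 c0 ec eb ec1 cs; have [m2e e4 Lp _] := scale_small e0 ae.
have [sL|Ls] := leP s L.
  by apply: (lower_tail_exp_mid e0 ae b0 c0) => //; [nra|rewrite cs].
have L8 : 64 * (b + 1) <= L.
  rewrite -(ler_pM2l e0); apply: le_trans e4; nra.
have cL : c <= L by rewrite -(ler_pM2l e0); apply: le_trans e4; lra.
pose u := s - L; have u0 : 0 < u by rewrite subr_gt0.
have [uL|Lu] := leP u L.
  apply: (@le_trans _ _ (P [set w | Z w < - L])).
    apply: le_measure; rewrite ?inE; [exact: measurable_centered_lt..|].
    by move=> w /=; lra.
  apply: le_trans (lower_tail_exp_mid (b := 2 * b) e0 ae _ c0 ec _ _) _ => //.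
  - by lra.
  - by nra.
  - by rewrite cL lexx.
  by rewrite lee_fin ler_expR; rewrite /u in uL; nra.
have -> : s = L + u by rewrite /u; lra.
apply: le_trans (far_lower_tail gW mp (ltW u0)) _; rewrite lee_fin ler_expR.
have : L * u <= u ^+ 2 by rewrite expr2 ler_wpM2r// ltW.
have : 64 * (b + 1) * u <= L * u by rewrite ler_wpM2r// ltW.
have : b * L <= b * u by rewrite ler_wpM2l// ltW.
nra.
Qed.

End Small.

(** * Consequences of the growth assumption *)

Section Growth.
Variable R : realType.

(** With y = ln x, exp y >= 1 + y^3 / 6, and y >= 6 / c makes c y^3 / 6 at least y^2. *)
Lemma ln_sqr_le (c x : R) : 0 < c -> 0 < x -> 6 / c <= ln x ->
  ln x ^+ 2 <= c * x.
Proof.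
move=> c0 x0 h; have y0 : 0 < ln x by apply: lt_le_trans h; rewrite divr_gt0.
have := expR_ge1Dxn 2 (ltW y0); rewrite lnK ?posrE// => hx.
have : c * (1 + ln x ^+ 3 / 6) <= c * x by rewrite ler_pM2l.
apply: le_trans; rewrite ler_pdivrMr// mulrC in h.
have : 6 * ln x ^+ 2 <= c * ln x * ln x ^+ 2 by rewrite ler_wpM2r ?sqr_ge0.
by rewrite exprS; lra.
Qed.

(* [m^3 (ln l)^2 = o(l)] is all that is needed of the growth of [m]. *)
Lemma cost_small (m p : nat) (e : R) : (2 <= m <= p)%N -> 0 < e -> e <= 1 ->
  let l := ln (p%:R : R) in
  expR 1 <= l -> m%:R ^+ 3 * ln l ^+ 2 <= e ^+ 2 / 4 * l ->
  m%:R ^+ 2 * (1 + ln (1 + scale R m p)) <= e * scale R m p.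
Proof.
move=> mp e0 e1 l le1 hm; have [m2 l0 L0 L2 _] := scaleP R mp.
rewrite -/l in l0 L2; set L := scale R m p in L0 L2 *.
have l2 : 2 <= l by apply: le_trans le1; exact: two_le_expR1.
have lnl1 : 1 <= ln l by rewrite -[leLHS]expRK ler_ln ?posrE ?expR_gt0//; lra.
have m3l : m%:R ^+ 3 <= l.
  apply: (@le_trans _ _ (m%:R ^+ 3 * ln l ^+ 2)).
    by rewrite ler_peMr ?exprn_ge0// exprn_ege1.
  by apply: le_trans hm _; rewrite ler_piMl//; nra.
have LL : L <= l.
  rewrite -(@ler_pXn2r _ 2) ?nnegrE// L2 expr2 ler_wpM2r//.
  by apply: le_trans m3l; rewrite exprS; nra.
have hln : 1 + ln (1 + L) <= 4 * ln l.
  have : ln (1 + L) <= ln (l ^+ 2).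
    by rewrite ler_ln ?posrE ?ltr_wpDr// ?exprn_gt0//; nra.
  by rewrite lnXn; lra.
apply: (@le_trans _ _ (m%:R ^+ 2 * (4 * ln l))).
  by rewrite ler_wpM2l// sqr_ge0.
rewrite -(@ler_pXn2r _ 2) ?nnegrE ?mulr_ge0 ?sqr_ge0 ?(ltW e0)//; last lra.
rewrite [leRHS]exprMn L2.
have -> : (m%:R ^+ 2 * (4 * ln l)) ^+ 2 = 16 * m%:R * (m%:R ^+ 3 * ln l ^+ 2).
  by ring.
have -> : e ^+ 2 * (4 * m%:R * l) = 16 * m%:R * (e ^+ 2 / 4 * l) by field.
by rewrite ler_wpM2l// mulr_ge0.
Qed.

Lemma near_lnln (p : nat -> nat) (K : R) : p @ \oo --> \oo ->
  \forall n \near \oo, K <= ln (ln (p n)%:R).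
Proof.
move=> /cvgnyPge/(_ (Num.truncn (expR (expR K))).+1); apply: filterS => n pn.
have : expR (expR K) <= (p n)%:R.
  by apply: le_trans (ltW (truncnS_gt _)) _; rewrite ler_nat.
have p0 : 0 < (p n)%:R :> R by rewrite ltr0n; apply: leq_ltn_trans pn.
rewrite -[in X in X -> _](lnK p0) ler_expR => h.
by rewrite -(ler_expR K) lnK// posrE (lt_le_trans (expR_gt0 _) h).
Qed.

Lemma slow_growth_cost (p m : nat -> nat) (e : R) : p @ \oo --> \oo ->
  (forall n, (2 <= m (p n) <= p n)%N) -> slow_growth R p (fun n => m (p n)) ->
  0 < e ->
  \forall n \near \oo, (m (p n))%:R ^+ 2 *
    (1 + ln (1 + scale R (m (p n)) (p n)))
    <= e * scale R (m (p n)) (p n).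
Proof.
move=> hp hm hg e0; pose e' := Num.min e 1.
have e'0 : 0 < e' by rewrite lt_min e0 ltr01.
have e'1 : e' <= 1 by rewrite ge_min lexx orbT.
pose c := e' ^+ 2 / 4; have c0 : 0 < c by rewrite divr_gt0// exprn_gt0.
have c1 : c <= 1 by rewrite /c; nra.
suff : \forall n \near \oo, (m (p n))%:R ^+ 3 * ln (ln (p n)%:R) ^+ 2 <= c *
  ln (p n)%:R.
  have h1 := near_lnln 1 hp.
  move=> h2; near=> n.
  have y1 : 1 <= ln (ln (p n)%:R : R) by near: n.
  have [_ l0 L0 _ _] := scaleP R (hm n).
  have l1 : expR 1 <= ln (p n)%:R :> R.
    rewrite -[leRHS]lnK ?ler_expR// posrE lt_neqAle l0 andbT eq_sym.
    by apply/eqP => l00; move: y1; rewrite l00 ln0//; lra.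
  apply: le_trans (cost_small (hm n) e'0 e'1 l1 _) _; first by near: n.
  by rewrite ler_wpM2r// ge_min lexx.
(* [ln] takes the value 0 on nonpositive arguments, so a logarithm of at least 1 has a positive
   argument. *)
have lpos n : 1 <= ln (ln (p n)%:R : R) -> 0 < ln (p n)%:R :> R.
  rewrite ltNge => y1; apply/negP => l0; move: y1; rewrite ln0//; lra.
case: hg => [[k mk]|[_ /eqoP mo]].
  have k0 : 0 < k%:R :> R by rewrite -(mk 0%N) ltr0n;
    have /andP[/ltnW] := hm 0%N.
  pose g := c / k%:R ^+ 3; have g0 : 0 < g by rewrite divr_gt0// exprn_gt0.
  have h1 := near_lnln 1 hp; have h2 := near_lnln (6 / g) hp.
  near=> n; rewrite mk.
  have y1 : 1 <= ln (ln (p n)%:R : R) by near: n.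
  have : ln (ln (p n)%:R) ^+ 2 <= g * ln (p n)%:R :> R.
    by apply: ln_sqr_le => //; [exact: lpos|near: n].
  rewrite /g mulrAC ler_pdivlMr ?exprn_gt0// mulrC.
  exact.
have h1 := near_lnln 1 hp; have h2 := mo c c0.
near=> n.
have y1 : 1 <= ln (ln (p n)%:R : R) by near: n.
have l0 := lpos _ y1.
have : `|(m (p n))%:R : R^o| <=
    c * `|ln (p n)%:R `^ 3^-1 / ln (ln (p n)%:R) : R^o| by near: n; exact: h2.
set l := ln (p n)%:R in l0 y1 *.
have y0 : 0 < ln l by lra.
rewrite ger0_norm// ger0_norm; last by rewrite divr_ge0 ?powR_ge0// ltW.
rewrite mulrA ler_pdivlMr// => h.
(* Cubing the little-o relation gives m^3 (ln l)^3 <= c^3 l, stronger than required since ln l >= 1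
   and c <= 1. *)
have h3 : ((m (p n))%:R * ln l) ^+ 3 <= (c * l `^ 3^-1) ^+ 3.
  by rewrite lerXn2r ?nnegrE ?mulr_ge0 ?powR_ge0// ltW.
have E : (l `^ 3^-1) ^+ 3 = l.
  by rewrite -powR_mulrn ?powR_ge0// -powRrM mulVf// powRr1// ltW.
rewrite [leLHS]exprMn [leRHS]exprMn E in h3.
apply: (@le_trans _ _ ((m (p n))%:R ^+ 3 * ln l ^+ 3)).
  by rewrite ler_wpM2l ?exprn_ge0// ler_weXn2l.
apply: le_trans h3 _; rewrite ler_wpM2r ?(ltW l0)// -[leRHS]expr1.
by apply: ler_wiXn2l => //; exact: ltW.
Unshelve. all: by end_near. Qed.

End Growth.

(** * From tail bounds to the two limits *)

Section Conclusion.
Variable R : realType.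

Lemma cvge0P (u : nat -> \bar R) : (forall n, 0 <= u n)%E ->
  (forall e : R, 0 < e -> \forall n \near \oo, (u n <= e%:E)%E) ->
  u @ \oo --> 0%E.
Proof.
move=> u0 ue; have ufin e n : (u n <= e%:E)%E -> u n \is a fin_num.
  by move=> h; rewrite ge0_fin_numE// (le_lt_trans h)// ltry.
apply/fine_cvgP; split; first by apply: filterS (ue 1 ltr01) => n /ufin.
apply/cvgrPdist_le => e e0; apply: filterS (ue e e0) => n h.
rewrite sub0r normrN ger0_norm ?fine_ge0// -lee_fin fineK//; exact: ufin h.
Qed.

Context d (T : measurableType d) (P : probability T R).

(* Slicing [{|Z| >= delta}] at the levels [delta + j]. *)
Lemma exp_moment_tail (Z : T -> R) (alpha delta eta : R) :
  measurable_fun setT Z -> 0 < alpha -> 0 < delta -> 0 < eta ->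
  let b := alpha + 1 + `|alpha + 1 - ln eta| / delta in
  (forall s, delta <= s -> (P [set w | (s <= `|Z w|)%R] <=
    (expR (- (b * s)))%:E)%E) ->
  ('E_P[(fun w => expR (alpha * `|Z w|) *
                        \1_[set w' | delta <= `|Z w'|] w)%R] <= eta%:E)%E.
Proof.
move=> mZ a0 d0 eta0 b tail; rewrite expectation.unlock.
pose B (j : nat) := [set w | delta + j%:R <= `|Z w|].
have mB j : measurable (B j).
  by apply: measurable_ge; exact: measurableT_comp.
pose c (j : nat) := expR (alpha * (delta + j%:R + 1)).
pose g (j : nat) w := ((c j)%:E * (\1_(B j) w)%:E)%E : \bar R.
have g0 j w : (0 <= g j w)%E by rewrite mule_ge0// lee_fin ?expR_ge0.
have mg j : measurable_fun setT (g j).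
  apply/emeasurable_funM; first exact: measurable_cst.
  by apply/measurable_EFinP; exact: measurable_indic.
apply: (@le_trans _ _ (\int[P]_w (\sum_(0 <= j <oo) g j w))%E).
  apply: ge0_le_integral => //.
  - apply/measurable_EFinP; apply: measurable_funM.
      apply: measurableT_comp => //; apply: measurable_funM => //.
      exact: measurableT_comp.
    apply: measurable_indic; apply: measurable_ge; exact: measurableT_comp.
  - by apply: ge0_emeasurable_sum => // j w _ _; exact: g0.
  (* The slice containing [Z w] already dominates the integrand; the other terms are nonnegative. *)
  move=> w _; rewrite indicE; case: (boolP (w \in _)) => [|_]; last first.
    by rewrite mulr0; apply: nneseries_ge0 => j _ _; exact: g0.
  rewrite inE/= mulr1 => dZ; pose j := Num.truncn (`|Z w| - delta).
  have [j1 j2] : j%:R <= `|Z w| - delta /\ `|Z w| - delta < j%:R + 1.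
    by rewrite natr1 truncnS_gt truncn_le subr_ge0.
  apply: (@le_trans _ _ (\sum_(0 <= i < j.+1) g i w)%E); last first.
    by apply: nneseries_lim_ge => i _ _; exact: g0.
  rewrite big_nat_recr//= -[leLHS]add0e; apply: leeD.
    by rewrite sume_ge0.
  rewrite /g indicE mem_set ?mule1; last by rewrite /B/=; lra.
  by rewrite lee_fin ler_expR ler_pM2l//; lra.
rewrite integral_nneseries//.
apply: (@le_trans _ _ (\sum_(0 <= j <oo) (0 + (eta / (2 ^ j.+1)%:R)%:E))%E);
  last first.
  apply: le_trans (epsilon_trick _ _ _) _ => //; first exact: ltW.
  by rewrite eseries0// add0e.
apply: lee_nneseries => [j _ _|j _]; first by rewrite integral_ge0.
rewrite add0e /g ge0_integralZl_EFin//; last 2 first.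
- by apply/measurable_EFinP; exact: measurable_indic.
- exact: expR_ge0.
rewrite integral_indic// setIT.
apply: (@le_trans _ _ ((c j)%:E * (expR (- (b * (delta + j%:R))))%:E)%E).
  by rewrite lee_wpmul2l ?lee_fin ?expR_ge0//; apply: tail; rewrite lerDl.
rewrite -EFinM lee_fin -expRD.
(* The choice of [b] makes slice [j] contribute at most eta exp (- (j + 1)), hence at most eta /
   2^(j + 1), and these sum to eta. *)
apply: (@le_trans _ _ (expR (ln eta - 1 * j.+1%:R))); last first.
  rewrite expRD lnK ?posrE// ler_pM2l// expRN lef_pV2 ?posrE ?expR_gt0 ?ltr0n
    ?expn_gt0//.
  by rewrite expRM_natr natrX lerXn2r ?nnegrE ?expR_ge0// two_le_expR1.
rewrite ler_expR mul1r -natr1 /b; set x := `|_ - ln eta| / delta.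
have : alpha + 1 - ln eta <= x * delta.
  by rewrite /x divfK ?gt_eqF// ler_norm.
have : 0 <= x * j%:R by rewrite mulr_ge0// divr_ge0// ltW.
nra.
Qed.

End Conclusion.

Theorem theorem2 (R : realType) (d : nat -> measure_display)
    (T : forall n : nat, measurableType (d n))
    (P : forall n : nat, probability (T n) R)
    (p m : nat -> nat)
    (W : forall n : nat, 'I_(p n) -> 'I_(p n) -> {RV (P n) >-> R})
    (hp : p @ \oo --> \oo)
    (hm : forall n : nat, (2 <= m (p n) <= p n)%N)
    (hW : forall n : nat, gaussian_symmetric (W n))
    (hgrowth : slow_growth R p (fun n => m (p n))) :
  let Z := fun (n : nat) (w : T n) => centered_max (m (p n)) (W n) w in
  cvg_in_probability0 P Z /\
  (forall alpha delta : R, 0 < alpha -> 0 < delta ->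
     'E_(P n)[(fun w => expR (alpha * `|Z n w|) *
                        \1_[set w' | delta <= `|Z n w'|] w)%R]%E
       @[n --> \oo] --> 0%E).
Proof.
move=> Z.
have mZ n : measurable_fun setT (Z n) by exact: measurable_centered_max.
have mabs n : measurable_fun setT (fun w => `|Z n w|)
  by exact: measurableT_comp.
have tails b c : 0 < b -> 0 < c -> \forall n \near \oo, forall s, c <= s ->
    (P n [set w | (s <= `|Z n w|)%R] <= (expR (- (b * s)))%:E)%E.
  (* The two one-sided bounds are applied at s / 2, which doubles the rate; as s / c >= 1, the extra
     1 / c absorbs the factor 2 from adding them. *)
  move=> b0 c0; pose b' := 2 * (b + c^-1); pose c' := c / 2.
  have ci0 : 0 < c^-1 by rewrite invr_gt0.
  have b'0 : 0 < b' by rewrite mulr_gt0// addr_gt0.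
  have c'0 : 0 < c' by rewrite divr_gt0.
  pose e := Num.min (c' / 96) (Num.min (16 * (b' + 1))^-1 c'^-1).
  have e0 : 0 < e by rewrite !lt_min divr_gt0//= !invr_gt0 c'0 andbT; lra.
  have e1 : 96 * e <= c' by rewrite mulrC -ler_pdivlMr// ge_min lexx.
  have e2 : e * (16 * (b' + 1)) <= 1.
    by rewrite -ler_pdivlMr ?div1r ?ge_min ?lexx ?orbT//; lra.
  have e3 : e * c' <= 1.
    by rewrite -ler_pdivlMr ?div1r ?ge_min ?lexx ?orbT//.
  apply: filterS (slow_growth_cost hp hm hgrowth e0) => n an s cs.
  have s1 : 1 <= c^-1 * s by rewrite mulrC ler_pdivlMr// mul1r.
  have c's : c' <= s / 2 by rewrite /c'; lra.
  apply: (@le_trans _ _ (P n ([set w | s / 2 <= Z n w] `|`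
    [set w | Z n w < - (s / 2)]))).
    apply: le_measure; rewrite ?inE.
    - exact: measurable_ge.
    - apply: measurableU; first exact: measurable_ge.
      exact: measurable_centered_lt.
    - move=> w /=; rewrite ler_normr => /orP[?|?]; [left; lra|right; lra].
  apply: le_trans (measureU2 _ _ _) _; first exact: measurable_ge.
    exact: measurable_centered_lt.
  apply: (@le_trans _ _ (2 * expR (- (b' * (s / 2))))%:E).
    rewrite mulr2n mulrDl mul1r EFinD; apply: leeD.
      exact: (upper_tail_exp (hW n) (hm n) e0 an b'0 c'0).
    exact: (lower_tail_exp (hW n) (hm n) e0 an b'0 c'0).
  rewrite lee_fin; apply: (@le_trans _ _ (expR 1 * expR (- (b' * (s / 2))))).
    by rewrite ler_wpM2r ?expR_ge0// two_le_expR1.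
  by rewrite -expRD ler_expR /b'; lra.
split=> [eps eps0|alpha delta a0 d0].
  (* With this rate exp (- b eps) = exp (- 1 - |ln e|) <= e. *)
  apply: cvge0P => // e e0; pose b := (1 + `|ln e|) / eps.
  have b0 : 0 < b by rewrite divr_gt0// ltr_pwDl.
  apply: filterS (tails b eps b0 eps0) => n /(_ eps (lexx _)) h.
  apply: (@le_trans _ _ (P n [set w | eps <= `|Z n w|])).
    apply: le_measure; rewrite ?inE;
      [|exact: measurable_ge|by move=> w /= /ltW].
    rewrite (_ : [set w | _] = ~` [set w | - eps <= - `|Z n w|]).
      apply: measurableC; apply: measurable_ge; exact: measurableT_comp.
    by apply/seteqP; split => w /=; rewrite lerN2 ltNge => /negP.
  apply: le_trans h _; rewrite lee_fin -[leRHS]lnK ?posrE// ler_expR.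
  rewrite /b divfK ?gt_eqF//; have := ler_norm (- ln e); rewrite normrN; lra.
apply: cvge0P => [n|e e0].
  by apply: expectation_ge0 => w; rewrite mulr_ge0 ?expR_ge0// indicE ler0n.
have b0 : 0 < alpha + 1 + `|alpha + 1 - ln e| / delta.
  by rewrite ltr_pwDl ?addr_gt0// divr_ge0// ltW.
apply: filterS (tails _ delta b0 d0) => n h.
exact: exp_moment_tail.
Qed.
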